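(* Let $\gamma>0$ and $\kappa_\ell>0$. There exist a gossip matrix $W$ (of size $n\times n$, $n$ being the number of nodes) with spectral gap $\gamma$ and $n\times m$ functions $f_{i,j}:\ell_2\to\mathbb{R}$ ($1\le i\le n$, $1\le j\le m$) such that each $f_{i,j}$ is convex and $L_{i,j}$-smooth, $f_i:=\sum_{j=1}^m f_{i,j}$ is $\sigma_i$-strongly convex, with $L_{i,j}$ and $\sigma_i$ such that $\kappa_\ell\ge L_{i,j}/\sigma_i$ for all $i,j$, and such that, if $f_i$ is the local function of node $i$, then for any black-box procedure the time to reach precision $\varepsilon$ is lower bounded by $$\Omega\left(\left[m+\sqrt{m\kappa_s}+\tau\sqrt{\frac{\kappa_\ell}{\gamma}}\right]\log(\varepsilon^{-1})\right),$$ where $\kappa_s\ge\sum_{j=1}^m L_{i,j}/\sigma_i$ and $\tau$ is the communication delay.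
   Context: A gossip matrix on a communication network with $n$ nodes is a symmetric positive semi-definite $n\times n$ matrix $W$ with $\mathrm{Ker}(W)=\mathrm{Span}(\mathbf{1})$ ($\mathbf{1}$ the all-ones vector) which is defined on the edges of the network: $W_{k\ell}=0$ if $\ell\ne k$ and $\ell\notin\mathcal{N}(k)$, where $\mathcal{N}(k)$ is the set of neighbours of node $k$. Its spectral gap (eigengap) is $\lambda_{\min}^+(W)/\lambda_{\max}(W)$, where $\lambda_{\min}^+$ is the smallest non-zero eigenvalue. The procedures below communicate over the network on which $W$ is defined. $\ell_2$ is the space of square-summable sequences. $f^*$ denotes the Fenchel conjugate of $f$ and $\mathrm{prox}_{\eta f}(x)=\arg\min_v \frac{1}{2\eta}\|v-x\|^2+f(v)$. Time model. Each node $i$ has $m$ local functions $f_{i,1},\dots,f_{i,m}$. Computing first-order characteristics (gradient, gradient of the conjugate, proximal operator) of one function $f_{i,j}$ takes time $1$. Nodes can only exchange vectors with their neighbours, and a communication takes time $\tau$. Black-box procedure. A distributed algorithm is a black-box procedure if it respects the following. 1. Local memory: each node $i$ can store past values in an internal memory $\mathcal{M}_{i,t}$ (a subset of the space on which the functions are defined, here $\ell_2$) at time $t\ge0$. These values can come either from local computation or from communication, so that for all $i$, $\mathcal{M}_{i,t}\subset\mathcal{M}_{i,t}^{\rm comm}\cup\mathcal{M}_{i,t}^{\rm comp}$. 2. Local computation: each node $i$ can, at time $t$, compute $\nabla f_{i,\zeta_t}(\theta)$, $\nabla f^*_{i,\zeta_t}(\theta)$ and $\mathrm{prox}_{\eta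 f_{i,\zeta_t}}(\theta)$ for some $\eta>0$, where $\zeta_t\in\{1,\dots,m\}$ is fixed for a given $t$ (but may be chosen by the algorithm, possibly at random). This means that $\mathcal{M}_{i,t}^{\rm comp}=\mathrm{Span}\big(\{\theta,\nabla f_{i,\zeta_t}(\theta),\nabla f^*_{i,\zeta_t}(\theta),\mathrm{prox}_{\eta f_{i,\zeta_t}}(\theta):\theta\in\mathcal{M}_{i,t-1}\},\ \eta\ge0\big)$. 3. Local communication: each node can, at time $t$, share a value with its neighbours, so that for all $i$, $\mathcal{M}_{i,t}^{\rm comm}=\mathrm{Span}\big(\bigcup_{j\in\mathcal{N}(i)}\mathcal{M}_{j,t-\tau}\big)$. 4. Output value: each node $i$ must, at time $t$, specify one vector of its memory as local output of the algorithm: $(\theta^t)_i\in\mathcal{M}_{i,t}$. With $\theta^*=\arg\min_\theta\sum_{i=1}^n f_i(\theta)$ and $\|\theta^t-\theta^*\|^2=\sum_{i=1}^n\|(\theta^t)_i-\theta^*\|^2$, precision is measured by the expected relative error $\mathbb{E}\big[\|\theta^t-\theta^*\|^2/\|\theta^0-\theta^*\|^2\big]$, and precision $\varepsilon$ is reached at time $t$ when this quantity is at most $\varepsilon$. $\Omega(\cdot)$ is the usual asymptotic lower-bound notation, hiding constant factors.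
   Formalization: Proved for γ ≤ 1 (a spectral gap never exceeds 1), κ_ℓ above and ε below absolute constants (the Ω regime; κ_ℓ < 1/m is impossible), κ_s ≤ mκ_ℓ (for unbounded κ_s the bound is false), and procedures whose memories start at 0. *)

(* Defs.v *)
From HB Require Import structures.
From mathcomp Require Import all_boot all_order all_algebra.
From mathcomp Require Import all_classical all_reals all_analysis.
From mathcomp Require Import ring lra.

Set Implicit Arguments.
Unset Strict Implicit.
Unset Printing Implicit Defensive.

Import Order.TTheory GRing.Theory Num.Theory.
Import numFieldNormedType.Exports.

Local Open Scope classical_set_scope.
Local Open Scope ring_scope.

Section SquareSummable.
Context {R : realType}.
Implicit Types u v : nat -> R^o.

Definition square_summable : {pred nat -> R^o} :=
  [pred u | `[< cvgn (series (fun k => u k ^+ 2 : R)) >]].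

Lemma square_summableP u :
  reflect (cvgn (series (fun k => u k ^+ 2 : R))) (u \in square_summable).
Proof. exact: asboolP. Qed.

Lemma square_summable_submod : submod_closed square_summable.
Proof.
split.
  apply/square_summableP.
  rewrite (_ : series _ = cst 0); first exact: is_cvg_cst.
  apply/funext => n; rewrite /series /= big1 // => k _.
  by rewrite [X in X ^+ 2](_ : _ = 0) // expr0n.
move=> a u v /square_summableP cu /square_summableP cv; apply/square_summableP.
have c2 : cvgn (series ((2 * a ^+ 2) *: (fun k => u k ^+ 2 : R)
                        + 2 *: (fun k => v k ^+ 2 : R))).
  by apply: is_cvg_seriesD; exact: is_cvg_seriesZ.
apply: series_le_cvg c2 => k; [exact: sqr_ge0| |].
  rewrite -[leRHS]/(2 * a ^+ 2 * u k ^+ 2 + 2 * v k ^+ 2).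
  have := sqr_ge0 (u k : R); have := sqr_ge0 (v k : R).
  by have := sqr_ge0 a; nra.
rewrite -[leLHS]/((a * u k + v k) ^+ 2).
rewrite -[leRHS]/(2 * a ^+ 2 * u k ^+ 2 + 2 * v k ^+ 2).
by have := sqr_ge0 (a * u k - v k); nra.
Qed.

HB.instance Definition _ :=
  GRing.isSubmodClosed.Build R (nat -> R^o) square_summable
    square_summable_submod.

End SquareSummable.

Record l2 (R : realType) := L2 {
  l2val :> nat -> R^o;
  l2valP : l2val \in square_summable }.

HB.instance Definition _ (R : realType) := [isSub for @l2val R].
HB.instance Definition _ (R : realType) := [Choice of l2 R by <:].
HB.instance Definition _ (R : realType) :=
  [SubChoice_isSubLmodule of l2 R by <:].

Section L2Norm.
Context {R : realType}.
Implicit Types (x y z : l2 R) (a : R).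

Definition l2dot x y : R := limn (series (fun k => x k * y k : R)).

Definition l2norm x : R := Num.sqrt (l2dot x x).

Lemma l2_is_cvg_sqr x : cvgn (series (fun k => x k ^+ 2 : R)).
Proof. exact/square_summableP/l2valP. Qed.

Lemma l2dot_is_cvg x y : cvgn (series (fun k => x k * y k : R)).
Proof.
apply: normed_cvg.
have c2 := is_cvg_seriesD (@l2_is_cvg_sqr x) (@l2_is_cvg_sqr y).
apply: series_le_cvg c2 => k /=; first exact: normr_ge0.
  by rewrite addr_ge0 ?sqr_ge0.
rewrite -[leRHS]/((x k ^+ 2 : R) + y k ^+ 2) ler_norml.
have := sqr_ge0 (x k + y k : R); have := sqr_ge0 (x k - y k : R).
have := sqr_ge0 (x k : R); have := sqr_ge0 (y k : R).
by move=> *; apply/andP; split; nra.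
Qed.

Lemma l2dotC x y : l2dot x y = l2dot y x.
Proof.
by congr (limn (series _)); apply/funext => k; rewrite mulrC.
Qed.

Lemma l2dotDl x y z : l2dot (x + y) z = l2dot x z + l2dot y z.
Proof.
rewrite /l2dot -lim_seriesD; [|exact: l2dot_is_cvg..].
by congr (limn (series _)); apply/funext => k; rewrite /= mulrDl.
Qed.

Lemma l2dotZl a x y : l2dot (a *: x) y = a * l2dot x y.
Proof.
rewrite /l2dot -[RHS]/(a *: (limn _ : R^o)) -lim_seriesZ;
  last exact: l2dot_is_cvg.
by congr (limn (series _)); apply/funext => k; rewrite /= -mulrA.
Qed.

Lemma l2dot_ge0 x : 0 <= l2dot x x.
Proof.
apply: limr_ge; first exact: l2dot_is_cvg.
by near=> n; rewrite /series /= sumr_ge0 // => k _; rewrite -expr2 sqr_ge0.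
Unshelve. all: by end_near. Qed.

Lemma l2dot_eq0 x : l2dot x x = 0 -> x = 0.
Proof.
move=> x0; apply/val_inj/funext => k /=.
have nd : nondecreasing_seq (series (fun k => x k * x k : R)).
  apply/nondecreasing_seqP => n; rewrite /series /= big_nat_recr //= lerDl.
  by rewrite -expr2 sqr_ge0.
have := nondecreasing_cvgn_le nd (@l2dot_is_cvg x x) k.+1.
rewrite -/(l2dot x x) x0 /series /= big_nat_recr //= => le0.
have s0 : 0 <= \sum_(0 <= i < k) (x i * x i : R).
  by apply: sumr_ge0 => i _; rewrite -expr2 sqr_ge0.
have /eqP : (x k : R) ^+ 2 = 0.
  by have := sqr_ge0 (x k : R); rewrite expr2 => ?; nra.
by rewrite sqrf_eq0 => /eqP.
Qed.

Lemma l2norm_sqr x : l2norm x ^+ 2 = l2dot x x.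
Proof. by rewrite sqr_sqrtr ?l2dot_ge0. Qed.

Lemma l2_cauchy_schwarz x y : l2dot x y <= l2norm x * l2norm y.
Proof.
have [->|y0] := eqVneq y 0.
  rewrite -[0](scale0r (0 : l2 R)) l2dotC l2dotZl mul0r.
  by rewrite mulr_ge0 ?sqrtr_ge0.
have y_gt0 : 0 < l2dot y y.
  by rewrite lt_def l2dot_ge0 andbT; apply/eqP => /l2dot_eq0 /eqP; apply/negP.
apply: le_trans (ler_norm _) _.
rewrite -ler_sqr ?nnegrE ?mulr_ge0 ?sqrtr_ge0 ?normr_ge0 //.
rewrite exprMn !l2norm_sqr real_normK ?num_real //.
have := l2dot_ge0 (l2dot y y *: x + (- l2dot x y) *: y).
rewrite !(l2dotDl, l2dotZl) ![l2dot _ (_ + _)]l2dotC !(l2dotDl, l2dotZl).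
rewrite (l2dotC y x) => h.
rewrite -subr_ge0 -(pmulr_rge0 _ y_gt0); apply: le_trans h _.
by rewrite le_eqVlt; apply/orP; left; apply/eqP; ring.
Qed.

Lemma l2normD x y : l2norm (x + y) <= l2norm x + l2norm y.
Proof.
rewrite -ler_sqr ?nnegrE ?addr_ge0 ?sqrtr_ge0 // l2norm_sqr sqrrD !l2norm_sqr.
rewrite l2dotDl ![l2dot _ (_ + _)]l2dotC !l2dotDl (l2dotC y x).
by have := l2_cauchy_schwarz x y; lra.
Qed.

Lemma l2normZ a x : l2norm (a *: x) = `|a| * l2norm x.
Proof.
rewrite /l2norm l2dotZl l2dotC l2dotZl mulrA -expr2.
by rewrite sqrtrM ?sqr_ge0 // sqrtr_sqr.
Qed.

Lemma l2norm_eq0 x : l2norm x = 0 -> x = 0.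
Proof. by move=> x0; apply: l2dot_eq0; rewrite -l2norm_sqr x0 expr0n. Qed.

End L2Norm.

HB.instance Definition _ (R : realType) :=
  Lmodule_isNormed.Build R (l2 R) (@l2normD R) (@l2normZ R) (@l2norm_eq0 R).

Section ConvexAnalysis.
Context {R : realType}.
Implicit Types (f : l2 R -> R) (x y v g : l2 R) (S : set (l2 R)).

Definition is_gradient f x g : Prop :=
  differentiable (f : l2 R -> R^o) x /\
  'd (f : l2 R -> R^o) x = l2dot g :> (l2 R -> R^o).

Definition convex f : Prop :=
  convex_function [set: convex_lmodType (l2 R)] f.

Definition smooth (L : R) f : Prop :=
  exists G : l2 R -> l2 R,
    (forall x, is_gradient f x (G x)) /\
    (forall x y, `|G x - G y| <= L * `|x - y|).

Definition strongly_convex (sigma : R) f : Prop :=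
  convex (fun x => f x - sigma / 2 * `|x| ^+ 2).

Definition is_argmin f x : Prop := forall y, f x <= f y.

Definition conjugate f y : \bar R :=
  ereal_sup [set (l2dot x y - f x)%:E | x in [set: l2 R]].

(* The conjugate may take the value +oo, so its gradient at [x] is only
   defined when it is finite around [x] and Frechet differentiable at [x]. *)
Definition is_conjugate_gradient f x g : Prop :=
  (\forall y \near x, conjugate f y \is a fin_num) /\
  is_gradient (fun y => fine (conjugate f y)) x g.

Definition is_prox (eta : R) f x v : Prop :=
  is_argmin (fun u => (2 * eta)^-1 * `|u - x| ^+ 2 + f u) v.

Definition lin_span S : set (l2 R) :=
  [set x | exists (k : nat) (a : 'I_k -> R) (s : 'I_k -> l2 R),
     (forall i, S (s i)) /\ x = \sum_i a i *: s i].

End ConvexAnalysis.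

Section Gossip.
Context {R : realType} {n : nat}.
Implicit Types (e : rel 'I_n) (W : 'M[R]_n).

Definition is_network e : Prop := symmetric e /\ irreflexive e.

Definition gossip_matrix e W : Prop :=
  [/\ W^T = W,
      forall x : 'cV[R]_n, 0 <= (x^T *m W *m x) 0 0,
      forall x : 'cV[R]_n, W *m x = 0 <-> exists a : R, x = const_mx a
    & forall k l, l != k -> ~~ e k l -> W k l = 0].

Definition has_spectral_gap W (gamma : R) : Prop :=
  exists lmin lmax : R,
    [/\ eigenvalue W lmin /\ lmin != 0,
        forall a, eigenvalue W a -> a != 0 -> lmin <= a,
        eigenvalue W lmax,
        forall a, eigenvalue W a -> a <= lmax
      & gamma = lmin / lmax].

End Gossip.

(* Time is a nonnegative real number.  Computations last one unit of time and
   are executed one after the other by each node: the [k]-th computation of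
   node [i] concerns the function [f i (zeta i k)] and occupies the time slot
   from [start i k] to [start i k + 1].  A memory that has been filled at some
   time remains usable later, and all memories are empty before time 0, so
   that every node starts from the span of the empty set, that is, from 0. *)

Record trace (R : realType) (n m : nat) := Trace {
  start : 'I_n -> nat -> R;
  zeta : 'I_n -> nat -> 'I_m;
  memory : 'I_n -> R -> set (l2 R);
  output : 'I_n -> R -> l2 R }.

Section BlackBox.
Context {R : realType} {n m : nat}.
Variables (e : rel 'I_n) (tau : R) (f : 'I_n -> 'I_m -> l2 R -> R).
Variable A : trace R n m.

Definition stored (i : 'I_n) (t : R) : set (l2 R) :=
  [set theta | exists2 s : R, 0 <= s <= t & memory A i s theta].

Definition first_order (h : l2 R -> R) (theta : l2 R) : set (l2 R) :=
  [set v | [\/ is_gradient h theta v,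
               is_conjugate_gradient h theta v
             | exists2 eta : R, 0 < eta & is_prox eta h theta v]].

Definition memory_comp (i : 'I_n) (t : R) : set (l2 R) :=
  lin_span (stored i (t - 1) `|`
    [set v | exists (k : nat) (theta : l2 R),
       [/\ start A i k + 1 <= t, stored i (start A i k) theta
         & first_order (f i (zeta A i k)) theta v]]).

Definition memory_comm (i : 'I_n) (t : R) : set (l2 R) :=
  lin_span [set theta | exists2 j, e i j & stored j (t - tau) theta].

Definition black_box : Prop :=
  [/\ forall i k, start A i k + 1 <= start A i k.+1,
      forall i t, 0 <= t ->
        memory A i t `<=` memory_comm i t `|` memory_comp i t
    & forall i t, 0 <= t -> memory A i t (output A i t)].

End BlackBox.

Definition relative_error (R : realType) (n m : nat) (thetas : l2 R) (t : R)
    (A : trace R n m) : R :=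
  (\sum_(i < n) `|output A i t - thetas| ^+ 2) /
  (\sum_(i < n) `|output A i 0 - thetas| ^+ 2).

(* A (possibly randomized) procedure is a random trace; all its choices,
   including [start] and [zeta], may depend on the sample point. *)
Definition black_box_procedure (R : realType) (n m : nat) (e : rel 'I_n)
    (tau : R) (f : 'I_n -> 'I_m -> l2 R -> R) (thetas : l2 R)
    d (T : measurableType d) (A : T -> trace R n m) : Prop :=
  (forall w, black_box e tau f (A w)) /\
  (forall t, 0 <= t ->
     measurable_fun [set: T] (fun w => relative_error thetas t (A w))).

Definition reaches_precision (R : realType) (n m : nat) (thetas : l2 R)
    d (T : measurableType d) (P : probability T R) (A : T -> trace R n m)
    (eps t : R) : Prop :=
  ('E_P[fun w => relative_error thetas t (A w)] <= eps%:E)%E.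

(* Main.v *)
From HB Require Import structures.
Require Import Defs.
From mathcomp Require Import all_boot all_order all_algebra.
From mathcomp Require Import all_classical all_reals all_analysis.
From mathcomp Require Import ring lra zify.
Import Order.TTheory GRing.Theory Num.Theory.
Import numFieldNormedType.Exports.
Local Open Scope classical_set_scope.
Local Open Scope ring_scope.

Set Implicit Arguments.
Unset Strict Implicit.
Unset Printing Implicit Defensive.

(* Identify a coordinate p with a block p %% m and a level p %/ m. Two nodes u
   and v hold quadratic functions: f_(u,j) and f_(v,j) couple, inside the block
   j only, the levels 2k+1 and 2k+2 (for u) or 2k and 2k+1 (for v), and the
   linear term of f_(u,j) points to level 0. All other nodes hold
   |theta_j|^2 / (2 n), so that they do not spoil the conditioning. The minimizer
   is q^level in every block, with 1 - q = 4 / sqrt kappa_l.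
   Every oracle commutes with the sign changes that preserve the function, so
   one call to f_(i,j) raises the highest known level of block j by at most one,
   only if i is u or v according to the parity of that level. Hence the levels
   known at time t add up to at most 2t over the m blocks (two nodes, one call
   per unit of time), and each level needs one transfer between u and v.
   The distance d between u and v is of order at least gamma^(-1/2): they are
   antipodal in a hypercube with one heavy direction, whose gap is tuned to be
   exactly gamma (for gamma > 1/2, a weighted triangle is enough). The bounds
   hold for every realization of the procedure, hence in expectation. *)

(** * Operators on square-summable sequences *)

Section L2Operators.
Context {R : realType}.
Implicit Types (x y z : l2 R) (a : R) (S : pred nat) (pi : nat -> nat).

Lemma l2P x y : (forall p, x p = y p) -> x = y.
Proof. by move=> xy; apply/val_inj/funext. Qed.

Lemma l2DE x y p : (x + y) p = x p + y p. Proof. by []. Qed.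
Lemma l2BE x y p : (x - y) p = x p - y p. Proof. by []. Qed.
Lemma l2ZE a x p : (a *: x) p = a * x p. Proof. by []. Qed.
Lemma l20E p : (0 : l2 R) p = 0. Proof. by []. Qed.

Lemma l2sumE (I : Type) (r : seq I) (P : pred I) (F : I -> l2 R) p :
  (\sum_(i <- r | P i) F i) p = \sum_(i <- r | P i) F i p.
Proof. by elim/big_rec2: _ => // i y x _ <-. Qed.

Lemma l2norm2E x : `|x| ^+ 2 = l2dot x x.
Proof. exact: l2norm_sqr. Qed.

Lemma l2dotDr x y z : l2dot x (y + z) = l2dot x y + l2dot x z.
Proof. by rewrite l2dotC l2dotDl !(l2dotC _ x). Qed.

Lemma l2dotZr a x y : l2dot x (a *: y) = a * l2dot x y.
Proof. by rewrite l2dotC l2dotZl l2dotC. Qed.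

Lemma l2dotNl x y : l2dot (- x) y = - l2dot x y.
Proof. by rewrite -scaleN1r l2dotZl mulN1r. Qed.

Lemma l2dotNr x y : l2dot x (- y) = - l2dot x y.
Proof. by rewrite l2dotC l2dotNl l2dotC. Qed.

Lemma l2dot0l x : l2dot 0 x = 0.
Proof. by rewrite -(scale0r 0) l2dotZl mul0r. Qed.

Lemma l2dot0r x : l2dot x 0 = 0.
Proof. by rewrite l2dotC l2dot0l. Qed.

Lemma l2dot_suml (I : Type) (r : seq I) (P : pred I) (F : I -> l2 R) x :
  l2dot (\sum_(i <- r | P i) F i) x = \sum_(i <- r | P i) l2dot (F i) x.
Proof.
by elim/big_rec2: _ => [|i y z _ <-]; [exact: l2dot0l|rewrite l2dotDl].
Qed.

Definition l2dotE :=
  (@l2dotDl R, l2dotDr, @l2dotZl R, l2dotZr, l2dotNl, l2dotNr).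

Lemma l2dot_le x y : l2dot x y <= `|x| * `|y|.
Proof. exact: l2_cauchy_schwarz. Qed.

Lemma l2dot_abs x y : `|l2dot x y| <= `|x| * `|y|.
Proof.
rewrite ler_norml l2dot_le andbT lerNl -l2dotNl.
by rewrite -(normrN x); exact: l2dot_le.
Qed.

(** Together with [norm2_le_partial_sum], this reduces bounds on norms to finite sums. *)
Lemma partial_sum_le x N : \sum_(0 <= p < N) (x p : R) ^+ 2 <= `|x| ^+ 2.
Proof.
rewrite l2norm2E.
have nd : nondecreasing_seq (series (fun k => x k * x k : R)).
  apply/nondecreasing_seqP => n; rewrite /series /= big_nat_recr //= lerDl.
  by rewrite -expr2 sqr_ge0.
have := nondecreasing_cvgn_le nd (@l2dot_is_cvg R x x) N.
by under eq_bigr do rewrite expr2.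
Qed.

Lemma norm2_le_partial_sum x (B : R) :
  (forall N, \sum_(0 <= p < N) (x p : R) ^+ 2 <= B) -> `|x| ^+ 2 <= B.
Proof.
move=> xB; rewrite l2norm2E; apply: limr_le; first exact: l2dot_is_cvg.
by near=> n; apply: le_trans (xB n); rewrite /series /=; under eq_bigr do rewrite -expr2.
Unshelve. all: by end_near. Qed.

Lemma partial_sum_bounded_summable (u : nat -> R^o) (B : R) :
  (forall N, \sum_(0 <= p < N) (u p : R) ^+ 2 <= B) -> u \in square_summable.
Proof.
move=> uB; apply/square_summableP; apply: nondecreasing_is_cvgn.
  apply/nondecreasing_seqP => n; rewrite /series /= big_nat_recr //= lerDl.
  exact: sqr_ge0.
by exists B => _ [n _ <-]; exact: uB.
Qed.

Fact l2mask_summable S x :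
  (fun p => if S p then x p else 0 : R^o) \in square_summable.
Proof.
apply: (@partial_sum_bounded_summable _ (`|x| ^+ 2)) => N.
apply: le_trans (partial_sum_le x N); apply: ler_sum => p _.
by case: ifP => // _; rewrite [X in X <= _]expr0n sqr_ge0.
Qed.
(* Locking keeps unification from unfolding the l2 structure of these terms. *)
Definition l2mask S x : l2 R := locked (L2 (l2mask_summable S x)).

Lemma l2maskE S x p : l2mask S x p = if S p then x p else 0.
Proof. by rewrite /l2mask; unlock. Qed.

Lemma l2maskD S x y : l2mask S (x + y) = l2mask S x + l2mask S y.
Proof. by apply: l2P => p; rewrite l2DE !l2maskE l2DE; case: ifP; rewrite ?addr0. Qed.

Lemma l2maskZ S a x : l2mask S (a *: x) = a *: l2mask S x.
Proof. by apply: l2P => p; rewrite l2ZE !l2maskE l2ZE; case: ifP; rewrite ?mulr0. Qed.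

Lemma l2maskB S x y : l2mask S (x - y) = l2mask S x - l2mask S y.
Proof. by rewrite l2maskD -scaleN1r l2maskZ scaleN1r. Qed.

Lemma l2mask0 S : l2mask S 0 = 0.
Proof. by rewrite -(scale0r 0) l2maskZ !scale0r. Qed.

Lemma l2mask_idem S x : l2mask S (l2mask S x) = l2mask S x.
Proof. by apply: l2P => p; rewrite !l2maskE; case: (S p). Qed.

Lemma l2maskC S T x : l2mask S (l2mask T x) = l2mask T (l2mask S x).
Proof. by apply: l2P => p; rewrite !l2maskE; case: (S p); case: (T p). Qed.

Lemma l2mask_dotl S x y : l2dot (l2mask S x) y = l2dot x (l2mask S y).
Proof.
congr (limn (series _)); apply/funext => p; rewrite !l2maskE.
by case: (S p); rewrite ?mul0r ?mulr0.
Qed.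

Lemma norm_mask S x : `|l2mask S x| <= `|x|.
Proof.
rewrite -ler_sqr ?nnegrE //; apply: norm2_le_partial_sum => N.
apply: le_trans (partial_sum_le x N); apply: ler_sum => p _.
by rewrite l2maskE; case: ifP => // _; rewrite [X in X <= _]expr0n sqr_ge0.
Qed.

Lemma l2mask_eq0P S x : reflect (forall p, S p -> x p = 0) (l2mask S x == 0).
Proof.
apply: (iffP eqP) => [Sx0 p Sp|x0].
  by have := congr1 (fun y : l2 R => y p) Sx0; rewrite l2maskE Sp.
by apply: l2P => p; rewrite l2maskE l20E; case: ifP => // /x0.
Qed.

(** An injection sends the first [N] indices to distinct indices of a longer window of length
    [M]. *)
Lemma perm_partial_sum_le pi x N : injective pi ->
  \sum_(0 <= p < N) (x (pi p) : R) ^+ 2 <= `|x| ^+ 2.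
Proof.
move=> pi_inj; set M := (\max_(0 <= p < N) (pi p).+1)%N.
apply: le_trans (partial_sum_le x M).
have lt_piM p : p \in index_iota 0 N -> (pi p < M)%N.
  by move=> pN; rewrite /M big_seq; apply: (@leq_bigmax_seq _ _ _ (fun p => (pi p).+1)).
rewrite -(big_map pi predT (fun p => (x p : R) ^+ 2)).
rewrite [leRHS](bigID (mem (map pi (index_iota 0 N)))) /= -[leLHS]addr0.
apply: lerD; last by apply: sumr_ge0 => p _; exact: sqr_ge0.
rewrite -[leRHS]big_filter le_eqVlt; apply/orP; left; apply/eqP.
apply: perm_big; apply: uniq_perm.
- by rewrite map_inj_uniq // iota_uniq.
- by rewrite filter_uniq // iota_uniq.
move=> p; rewrite mem_filter andb_idr // => /mapP[r rN ->].
by rewrite mem_index_iota /= lt_piM.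
Qed.

Section Permute.
Variables (pi : nat -> nat) (piK : involutive pi).

Fact permute_summable x : (fun p => x (pi p)) \in square_summable.
Proof.
apply: (@partial_sum_bounded_summable _ (`|x| ^+ 2)) => N.
exact: perm_partial_sum_le (can_inj piK).
Qed.
Definition permute x : l2 R := locked (L2 (permute_summable x)).

Lemma permuteE x p : permute x p = x (pi p).
Proof. by rewrite /permute; unlock. Qed.

Lemma permuteK : involutive permute.
Proof. by move=> x; apply: l2P => p; rewrite !permuteE piK. Qed.

Lemma permuteD x y : permute (x + y) = permute x + permute y.
Proof. by apply: l2P => p; rewrite l2DE !permuteE l2DE. Qed.

Lemma permuteZ a x : permute (a *: x) = a *: permute x.
Proof. by apply: l2P => p; rewrite l2ZE !permuteE l2ZE. Qed.

Lemma norm_permute x : `|permute x| = `|x|.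
Proof.
have le y : `|permute y| <= `|y|.
  rewrite -ler_sqr ?nnegrE //; apply: norm2_le_partial_sum => N.
  under eq_bigr do rewrite permuteE.
  exact: perm_partial_sum_le (can_inj piK).
by apply/le_anti; rewrite le/= -[X in `|X| <= _]permuteK le.
Qed.

(* Polarization. *)
Lemma permute_dotl x y : l2dot (permute x) y = l2dot x (permute y).
Proof.
have iso z : l2dot (permute z) (permute z) = l2dot z z.
  by rewrite -!l2norm2E norm_permute.
have := iso (x + permute y); rewrite permuteD permuteK !l2dotE.
have := iso (permute y); rewrite permuteK => ->.
by rewrite iso (l2dotC y) (l2dotC (permute y) x) => ?; lra.
Qed.

End Permute.

End L2Operators.

(** * Quadratic functions of positive self-adjoint operators *)

Section Quadratic.
Context {R : realType}.
Implicit Types (x y z b v : l2 R) (a : R) (S : pred nat) (H : l2 R -> l2 R).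

Record psd H : Prop := PSD {
  psdD : forall x y, H (x + y) = H x + H y;
  psdZ : forall a x, H (a *: x) = a *: H x;
  psd_sym : forall x y, l2dot (H x) y = l2dot x (H y);
  psd_ge0 : forall x, 0 <= l2dot (H x) x }.

Lemma psdB H x y : psd H -> H (x - y) = H x - H y.
Proof. by move=> Hp; rewrite (psdD Hp) -scaleN1r (psdZ Hp) scaleN1r. Qed.

Lemma psd_id : psd id.
Proof. by split=> // x; exact: l2dot_ge0. Qed.

Lemma psd_zero : psd (fun=> 0 : l2 R).
Proof.
split=> [x y|a x|x y|x]; rewrite ?addr0 ?scaler0//.
  by rewrite l2dot0l l2dot0r.
by rewrite l2dot0l.
Qed.

Lemma psd_scale a H : 0 <= a -> psd H -> psd (fun x => a *: H x).
Proof.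
move=> a0 Hp; split=> [x y|b x|x y|x].
- by rewrite (psdD Hp) scalerDr.
- by rewrite (psdZ Hp) !scalerA mulrC.
- by rewrite l2dotZl l2dotZr (psd_sym Hp).
- by rewrite l2dotZl mulr_ge0 ?(psd_ge0 Hp).
Qed.

Lemma psd_add H1 H2 : psd H1 -> psd H2 -> psd (fun x => H1 x + H2 x).
Proof.
move=> p1 p2; split=> [x y|b x|x y|x].
- by rewrite (psdD p1) (psdD p2) addrACA.
- by rewrite (psdZ p1) (psdZ p2) scalerDr.
- by rewrite l2dotDl l2dotDr (psd_sym p1) (psd_sym p2).
- by rewrite l2dotDl addr_ge0 ?(psd_ge0 p1) ?(psd_ge0 p2).
Qed.

Lemma psd_sum (I : finType) (H : I -> l2 R -> l2 R) : (forall i, psd (H i)) ->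
  psd (fun x => \sum_i H i x).
Proof.
move=> Hp; split=> [x y|a x|x y|x].
- by rewrite -big_split/=; apply: eq_bigr => i _; rewrite (psdD (Hp i)).
- by rewrite scaler_sumr; apply: eq_bigr => i _; rewrite (psdZ (Hp i)).
- rewrite [RHS]l2dotC !l2dot_suml; apply: eq_bigr => i _.
  by rewrite (psd_sym (Hp i)) l2dotC.
- by rewrite l2dot_suml sumr_ge0 // => i _; exact: (psd_ge0 (Hp i)).
Qed.

(** The permutation is an isometry, so Cauchy-Schwarz bounds its form by the squared norm. *)
Lemma psd_laplacian pi (piK : involutive pi) : psd (fun x => x - permute piK x).
Proof.
split=> [x y|a x|x y|x].
- by rewrite permuteD opprD addrACA.
- by rewrite permuteZ scalerBr.
- by rewrite !l2dotE permute_dotl.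
- rewrite !l2dotE subr_ge0 (le_trans (l2dot_le _ _)) //.
  by rewrite norm_permute -expr2 l2norm2E.
Qed.

(** The projection commutes with [H], so the form at [x] is that of [H] at the projection of [x]. *)
Lemma psd_mask S H : (forall x, l2mask S (H x) = H (l2mask S x)) ->
  psd H -> psd (fun x => l2mask S (H x)).
Proof.
move=> SH Hp; split=> [x y|a x|x y|x].
- by rewrite (psdD Hp) l2maskD.
- by rewrite (psdZ Hp) l2maskZ.
- by rewrite l2mask_dotl (psd_sym Hp) SH.
- by rewrite -l2mask_idem l2mask_dotl SH (psd_ge0 Hp).
Qed.

Definition quad H b x : R := l2dot (H x) x / 2 - l2dot b x.

(** The second-order expansion is exact with a nonnegative remainder; minimizers and gradients are
    read off it. *)
Lemma quadD H b x h : psd H ->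
  quad H b (x + h) = quad H b x + l2dot (H x - b) h + l2dot (H h) h / 2.
Proof.
move=> Hp; rewrite /quad (psdD Hp) !l2dotE (psd_sym Hp h x) (l2dotC h (H x)).
by field.
Qed.

Lemma quad_sum (I : finType) (H : I -> l2 R -> l2 R) (b : I -> l2 R) x :
  \sum_i quad (H i) (b i) x = quad (fun x => \sum_i H i x) (\sum_i b i) x.
Proof. by rewrite /quad big_split/= sumrN -mulr_suml !l2dot_suml. Qed.

Lemma quad_argmin H b x : psd H -> H x = b -> is_argmin (quad H b) x.
Proof.
move=> Hp Hx y; rewrite -(subrKC x y) (quadD b x _ Hp) Hx subrr l2dot0l addr0 lerDl.
by rewrite divr_ge0 // (psd_ge0 Hp).
Qed.

Lemma quad_convex H b : psd H -> convex (quad H b).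
Proof.
move=> Hp t x y _ _; rewrite convRE.
rewrite -[X in quad H b X]/((t%:num) *: (x : l2 R) + (1 - t%:num) *: (y : l2 R)).
have s0 : 0 <= t%:num by [].
have s1 : t%:num <= 1 by exact: le1.
move: (t%:num) s0 s1 => s s0 s1.
rewrite /quad (psdD Hp) !(psdZ Hp) !l2dotE.
(* The convexity gap is [s * (1 - s) / 2] times the form at [x - y]. *)
have := psd_ge0 Hp ((x : l2 R) - y); rewrite (psdB _ _ Hp) !l2dotE.
rewrite (psd_sym Hp y x) (l2dotC y (H x)) => h.
have : 0 <= s * (1 - s) * (l2dot (H x) x + l2dot (H y) y - 2 * l2dot (H x) y).
  by rewrite !mulr_ge0 ?subr_ge0//; lra.
by rewrite /unstable.onem; lra.
Qed.

Fact l2dot_is_linear b : linear (l2dot b : l2 R -> R^o).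
Proof. by move=> a x y; rewrite l2dotDr l2dotZr. Qed.
HB.instance Definition _ b := GRing.isLinear.Build R (l2 R) R^o *:%R (l2dot b)
  (l2dot_is_linear b).

Lemma l2dot_continuous b : continuous (l2dot b : l2 R -> R^o).
Proof.
apply: (@bounded_linear_continuous _ _ _ (l2dot b : {linear l2 R -> R^o})).
apply/linear_boundedP; near=> r => x; apply: le_trans (l2dot_abs b x) _.
by rewrite ler_wpM2r.
Unshelve. all: by end_near. Qed.

Lemma quad_gradient H b (L : R) x : psd H -> (forall z, `|H z| <= L * `|z|) ->
  is_gradient (quad H b) x (H x - b).
Proof.
move=> Hp HL.
have o : (quad H b : l2 R -> R^o) \o shift x =
    cst (quad H b x : R^o) + (l2dot (H x - b) : l2 R -> R^o) +o_ (0 : l2 R) id.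
  apply/eqaddoP => _/posnumP[eps]; near=> h => /=.
  rewrite -[X in `|X|]/(quad H b (h + x) - (quad H b x + l2dot (H x - b) h)).
  rewrite (addrC h x) (quadD b x h Hp) addrAC subrr add0r.
  rewrite ger0_norm ?divr_ge0 ?(psd_ge0 Hp)//.
  apply: (@le_trans _ _ (`|L| * `|h| * `|h| / 2)).
    rewrite ler_pM2r// (le_trans (l2dot_le _ _))// ler_wpM2r//.
    by rewrite (le_trans (HL h))// ler_wpM2r// ler_norm.
  rewrite mulrAC ler_wpM2r//.
  (* This gives [|L| * |h| <= eps]; the added 1 covers [L = 0]. *)
  have : `|h| <= eps%:num / (`|L| + 1).
    near: h; apply: nbhs0_le; rewrite divr_gt0// ltr_wpDl//.
  rewrite ler_pdivlMr ?ltr_wpDl// => h1.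
  have := normr_ge0 h; have := normr_ge0 L; nra.
have E := diff_unique (@l2dot_continuous (H x - b)) o.
split; last exact: E.
by apply/diff_locallyP; rewrite E; split => //; exact: l2dot_continuous.
Unshelve. all: by end_near. Qed.

Lemma quad_smooth H b (L : R) : psd H -> (forall z, `|H z| <= L * `|z|) ->
  smooth L (quad H b).
Proof.
move=> Hp HL; exists (fun x => H x - b); split=> [x|x y].
  exact: quad_gradient HL.
by rewrite opprB addrA subrK -(psdB _ _ Hp).
Qed.

Lemma quad_strongly_convex H b (s : R) : psd H ->
  strongly_convex s (quad (fun x => s *: x + H x) b).
Proof.
move=> Hp; rewrite /strongly_convex.
rewrite [X in convex X](_ : _ = quad H b); first exact: quad_convex.
apply/funext => x; rewrite /quad l2norm2E !l2dotE.
by field.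
Qed.

End Quadratic.

(** * Sign changes of coordinates and first-order oracles *)

Section Reflection.

Context {R : realType}.
Implicit Types (x y z b v : l2 R) (a eta : R) (S : pred nat) (f : l2 R -> R).

Definition reflection S x : l2 R := x - 2 *: l2mask S x.

Lemma reflection_dot S x y : l2dot (reflection S x) y = l2dot x (reflection S y).
Proof. by rewrite /reflection !l2dotE l2mask_dotl. Qed.

Lemma reflectionE S x p : reflection S x p = if S p then - x p else x p.
Proof.
rewrite /reflection l2BE l2ZE l2maskE; case: (S p); last by rewrite mulr0 subr0.
by rewrite mulr_natl mulr2n opprD addNKr.
Qed.

Lemma reflectionK S : involutive (reflection S).
Proof.
by move=> x; apply: l2P => p; rewrite !reflectionE; case: (S p); rewrite ?opprK.
Qed.

Lemma reflection_fixed S x : l2mask S x = 0 -> reflection S x = x.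
Proof. by move=> Sx0; rewrite /reflection Sx0 scaler0 subr0. Qed.

Lemma reflectionD S x y : reflection S (x + y) = reflection S x + reflection S y.
Proof. by rewrite /reflection l2maskD scalerDr opprD addrACA. Qed.

Lemma reflectionZ S a x : reflection S (a *: x) = a *: reflection S x.
Proof. by rewrite /reflection l2maskZ scalerBr !scalerA mulrC. Qed.

(** At a point fixed by the reflection, the derivatives along [h] and along its reflection agree.
    Taking [h = g] shows that [g] has no component in [S]. *)
Lemma gradient_reflection S f x g : (forall y, f (reflection S y) = f y) ->
  l2mask S x = 0 -> is_gradient f x g -> l2mask S g = 0.
Proof.
move=> fS Sx0 [fx dfx].
have inv h : l2dot g (reflection S h) = l2dot g h.
  rewrite -dfx -!deriveE// /derive.
  under eq_fun do rewrite /= -{1}(reflection_fixed Sx0) -reflectionZ -reflectionD fS.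
  by [].
apply: l2dot_eq0; have := inv g; rewrite /reflection !l2dotE => gg.
by rewrite l2mask_dotl l2mask_idem; lra.
Qed.

(** The reflection is a self-adjoint involution, so it merely reindexes the supremum. *)
Lemma conjugate_reflection S f y : (forall x, f (reflection S x) = f x) ->
  conjugate f (reflection S y) = conjugate f y.
Proof.
move=> fS; congr (ereal_sup _); apply/seteqP; split=> _ [x _ <-];
  exists (reflection S x) => //.
  by rewrite fS reflection_dot.
by rewrite fS reflection_dot reflectionK.
Qed.

Lemma convex_midpoint f x y : convex f ->
  f (2^-1 *: (x + y)) <= 2^-1 * (f x + f y).
Proof.
have h1 : 0 <= (2^-1 : R) <= 1 by apply/andP; split; lra.
move=> /(_ (Itv01 (andP h1).1 (andP h1).2) x y).
rewrite !inE => /(_ I I).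
rewrite convRE => h.
have {h} : f (2^-1 *: x + (1 - 2^-1) *: y) <= 2^-1 * f x + (1 - 2^-1) * f y.
  exact: h.
by rewrite (_ : 1 - 2^-1 = 2^-1) -?mulrDr -?scalerDr//; lra.
Qed.

Lemma l2mask_pythagoras S x v : l2mask S x = 0 ->
  `|v - x| ^+ 2 = `|v - l2mask S v - x| ^+ 2 + `|l2mask S v| ^+ 2.
Proof.
move=> Sx0; set w := v - l2mask S v.
have {1}-> : v = w + l2mask S v by rewrite subrK.
have Sw0 : l2mask S w = 0 by rewrite /w l2maskB l2mask_idem subrr.
have d : l2dot (w - x) (l2mask S v) = 0.
  by rewrite -l2mask_dotl l2maskB Sw0 Sx0 subrr l2dot0l.
rewrite addrAC; move: (w - x) (l2mask S v) d => y z d.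
by rewrite !l2norm2E l2dotDl !l2dotDr (l2dotC z y) d addr0 add0r.
Qed.

Let prox_gap (c A B C fw fv : R) : 0 < c -> fw <= fv -> C = A + B ->
  c * C + fv <= c * A + fw -> B <= 0.
Proof. by move=> c_gt0 ? -> ?; rewrite -(pmulr_rle0 _ c_gt0); lra. Qed.

(** Erasing the coordinates of [v] in [S] gives the midpoint [w] of [v] and its reflection. By
    convexity [f] does not increase, while the squared distance to [x] drops by the squared norm of
    the erased part; at a minimizer that part is zero. *)
Lemma prox_reflection S f eta x v : 0 < eta -> convex f ->
  (forall y, f (reflection S y) = f y) ->
  l2mask S x = 0 -> is_prox eta f x v -> l2mask S v = 0.
Proof.
move=> eta0 fc fS Sx0 v_min.
have c0 : 0 < (2 * eta)^-1 by rewrite invr_gt0 mulr_gt0.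
have [w wE] : exists w, w = v - l2mask S v by exists (v - l2mask S v).
have le_f : f w <= f v.
  have := convex_midpoint v (reflection S v) fc; rewrite fS.
  rewrite (_ : 2^-1 *: _ = w); first by move=> h; apply: le_trans h _; lra.
  rewrite wE /reflection addrA -mulr2n scaler_nat -mulrnBl.
  by rewrite -(scaler_nat 2 (v - _)) scalerA mulVf ?pnatr_eq0// scale1r.
have pyth := l2mask_pythagoras v Sx0; rewrite -wE in pyth.
have := prox_gap c0 le_f pyth (v_min w).
rewrite l2norm2E => h.
by apply: l2dot_eq0; apply/le_anti; rewrite l2dot_ge0 andbT.
Qed.

Lemma first_order_reflection S f x v : convex f ->
  (forall y, f (reflection S y) = f y) ->
  l2mask S x = 0 -> first_order f x v -> l2mask S v = 0.
Proof.
move=> fc fS Sx0 [|[_]|[eta eta0]].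
- exact: gradient_reflection.
- by apply: gradient_reflection => // y; rewrite conjugate_reflection.
- exact: prox_reflection.
Qed.

Lemma quad_reflection S (H : l2 R -> l2 R) b x : psd H ->
  (forall y, l2mask S (H y) = H (l2mask S y)) -> l2mask S b = 0 ->
  quad H b (reflection S x) = quad H b x.
Proof.
move=> Hp SH Sb0; rewrite /quad -!reflection_dot (reflection_fixed Sb0).
rewrite reflection_dot.
have -> : H (reflection S x) = reflection S (H x).
  by rewrite /reflection (psdB _ _ Hp) (psdZ Hp) SH.
by rewrite -reflection_dot reflectionK.
Qed.

Lemma lin_span_mask S (A : set (l2 R)) x :
  (forall y, A y -> l2mask S y = 0) -> lin_span A x -> l2mask S x = 0.
Proof.
move=> AS [k [a [s [sA ->]]]].
elim/big_ind: _ => [|y z y0 z0|i _]; first exact: l2mask0.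
  by rewrite l2maskD y0 z0 addr0.
by rewrite l2maskZ AS ?scaler0.
Qed.

End Reflection.

(** * The hard functions *)

(** For [b = false] the pairs are (1,2), (3,4), ... and level 0 is fixed because [0.-1 = 0]; for
    [b = true] they are (0,1), (2,3), ... *)
Definition level_swap (b : bool) (k : nat) : nat :=
  if odd k (+) b then k.+1 else k.-1.

Lemma level_swapK b : involutive (level_swap b).
Proof. by move=> k; rewrite /level_swap; case: b; case: ifP; case: ifP; lia. Qed.

(** A threshold of this parity falls between two pairs and splits none. *)
Lemma leq_level_swap b k l : odd k (+) b -> (k <= level_swap b l)%N = (k <= l)%N.
Proof. by rewrite /level_swap; case: b; case: ifP; lia. Qed.

Section Coordinates.
Variables (m : nat) (m_gt0 : (0 < m)%N).

Definition coord_swap b p := (level_swap b (p %/ m) * m + p %% m)%N.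

Lemma coord_swap_mod b p : (coord_swap b p %% m = p %% m)%N.
Proof. by rewrite /coord_swap modnMDl modn_mod. Qed.

Lemma coord_swap_div b p : (coord_swap b p %/ m = level_swap b (p %/ m))%N.
Proof. by rewrite /coord_swap divnMDl// (@divn_small (p %% m)) ?ltn_mod// addn0. Qed.

Lemma coord_swapK b : involutive (coord_swap b).
Proof.
move=> p; rewrite {1}/coord_swap coord_swap_div coord_swap_mod level_swapK.
by rewrite -divn_eq.
Qed.

Lemma big_nat_block (V : nmodType) (F : nat -> V) K :
  \sum_(0 <= p < K * m) F p = \sum_(0 <= k < K) \sum_(j < m) F (k * m + j)%N.
Proof.
elim: K => [|K IH]; first by rewrite mul0n !big_geq.
rewrite big_nat_recr//= -IH mulSn addnC (big_cat_nat _ (leq_addr _ _))//=.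
congr (_ + _); rewrite -{1}(add0n (K * m)%N) big_addn addnC addnK big_mkord.
by apply: eq_bigr => j _; rewrite addnC.
Qed.

Definition block j : pred nat := fun p => (p %% m == j)%N.
(** Vanishing on [tail j k] measures ignorance: nothing is known of block [j] from level [k] on. *)
Definition tail j k : pred nat := fun p => (p %% m == j)%N && (k <= p %/ m)%N.

End Coordinates.

Lemma geometric_sum (R : realType) (r : R) K :
  (1 - r) * \sum_(0 <= k < K) r ^+ k = 1 - r ^+ K.
Proof.
elim: K => [|K IH]; first by rewrite big_geq// mulr0 expr0 subrr.
by rewrite big_nat_recr//= mulrDr IH exprS; ring.
Qed.

Section HardInstance.
Context {R : realType}.
Variables (m n : nat) (m_gt0 : (0 < m)%N) (u v : 'I_n) (u_neq_v : u != v).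
Variables (sigma : 'I_n -> R) (sigma_gt0 : forall i, 0 < sigma i).
Variables (q c : R) (q_gt0 : 0 < q) (q_lt1 : q < 1).
Implicit Types (x y : l2 R) (i : 'I_n) (j : 'I_m).

Let mu := \sum_i sigma i.
(** Stationarity of [q ^+ level] at every positive level: the curvature [mu] balances the two
    couplings of strength [c]. *)
Hypothesis c_def : mu * q = c * (1 - q) ^+ 2.

Let c_gt0 : 0 < c.
Proof.
have mu_gt0 : 0 < mu.
  by rewrite /mu (bigD1 u)//= ltr_wpDr// sumr_ge0// => i _; exact: ltW.
rewrite -(pmulr_lgt0 _ (_ : 0 < (1 - q) ^+ 2)); last by rewrite exprn_gt0// subr_gt0.
by rewrite -c_def mulr_gt0.
Qed.

Let q2_lt1 : 0 < 1 - q ^+ 2.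
Proof. by rewrite subr_gt0 expr_lt1// ltW. Qed.

Lemma thetas_partial_sum K :
  \sum_(0 <= p < K * m) (q ^+ (p %/ m)) ^+ 2 =
  m%:R * ((1 - q ^+ 2 ^+ K) / (1 - q ^+ 2)).
Proof.
rewrite big_nat_block -geometric_sum mulrAC mulfV ?gt_eqF// mul1r mulr_sumr.
apply: eq_bigr => k _; rewrite (eq_bigr (fun=> (q ^+ 2) ^+ k)) => [|j _].
  by rewrite sumr_const card_ord mulr_natl.
by rewrite divnMDl// divn_small// addn0 exprAC.
Qed.

Lemma thetas_partial_le N :
  \sum_(0 <= p < N) (q ^+ (p %/ m)) ^+ 2 <= m%:R / (1 - q ^+ 2).
Proof.
apply: (@le_trans _ _ (\sum_(0 <= p < N * m) (q ^+ (p %/ m)) ^+ 2)).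
  rewrite [leRHS](big_cat_nat _ (leq_pmulr N m_gt0))//= lerDl sumr_ge0// => p _.
  exact: sqr_ge0.
rewrite thetas_partial_sum ler_wpM2l//.
apply: ler_piMl; first by rewrite invr_ge0 ltW.
by rewrite gerBl exprn_ge0// sqr_ge0.
Qed.

Definition thetas : l2 R :=
  locked (L2 (partial_sum_bounded_summable thetas_partial_le)).

Lemma thetasE p : thetas p = q ^+ (p %/ m).
Proof. by rewrite /thetas; unlock. Qed.

Lemma norm_thetas_le : `|thetas| ^+ 2 <= m%:R / (1 - q ^+ 2).
Proof.
apply: norm2_le_partial_sum => N; under eq_bigr do rewrite thetasE.
exact: thetas_partial_le.
Qed.

Lemma thetas_neq0 : 0 < `|thetas| ^+ 2.
Proof.
apply: lt_le_trans (partial_sum_le thetas 1).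
by rewrite big_nat1 thetasE div0n expr0 expr1n.
Qed.

Definition swap b : l2 R -> l2 R := permute (@coord_swapK m m_gt0 b).

Definition laplacian i x : l2 R :=
  if i == u then x - swap false x else if i == v then x - swap true x else 0.

Definition node_op i x : l2 R := sigma i *: x + c *: laplacian i x.

Definition hess i j x : l2 R := l2mask (block m j) (node_op i x).

(** Since [thetas] is 1 on level 0, this is a multiple of the indicator of level 0, scaled to
    satisfy the stationarity equation there. *)
Definition source : l2 R :=
  (mu + c - c * q) *: l2mask (fun p => (p < m)%N) thetas.

Definition lin i j : l2 R := if i == u then l2mask (block m j) source else 0.

Definition hard i j : l2 R -> R := quad (hess i j) (lin i j).

Lemma psd_laplacian_node i : psd (laplacian i).
Proof.
rewrite /laplacian; case: eqP => _; first exact: psd_laplacian.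
by case: eqP => _; [exact: psd_laplacian|exact: psd_zero].
Qed.

Lemma psd_node i : psd (node_op i).
Proof.
apply: psd_add; first exact: (psd_scale (ltW (sigma_gt0 i)) psd_id).
exact: (psd_scale (ltW c_gt0) (psd_laplacian_node i)).
Qed.

(** Conditions on the pairs used at a node can thus be stated once: they concern [swap false] at
    [u], [swap true] at [v], and are vacuous elsewhere. *)
Definition paired_at i b := i == (if b then v else u).

Lemma node_op_l2mask i (S : pred nat) x p :
  (forall b, paired_at i b -> S (coord_swap m b p) = S p) ->
  l2mask S (node_op i x) p = node_op i (l2mask S x) p.
Proof.
rewrite /paired_at l2maskE /node_op /laplacian /swap => Sb.
have [iu|_] := eqVneq i u; last have [iv|_] := eqVneq i v.
- rewrite !(l2BE, l2DE, l2ZE, l2maskE, permuteE) (Sb false) ?iu//.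
  by case: (S p) => //; rewrite !(mulr0, subr0, addr0).
- rewrite !(l2BE, l2DE, l2ZE, l2maskE, permuteE) (Sb true) ?iv//.
  by case: (S p) => //; rewrite !(mulr0, subr0, addr0).
- rewrite !(l2DE, l2ZE, l2maskE) l20E.
  by case: (S p) => //; rewrite !(mulr0, addr0).
Qed.

Lemma node_op_block i j x :
  l2mask (block m j) (node_op i x) = node_op i (l2mask (block m j) x).
Proof.
by apply: l2P => p; apply: node_op_l2mask => b _; rewrite /block coord_swap_mod.
Qed.

Lemma hess_l2mask i j (S : pred nat) x :
  (forall b p, paired_at i b -> block m j p -> S (coord_swap m b p) = S p) ->
  l2mask S (hess i j x) = hess i j (l2mask S x).
Proof.
move=> Sb; rewrite /hess l2maskC; apply: l2P => p; rewrite ![l2mask (block _ _) _ _]l2maskE.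
by case: ifP => // jp; apply: node_op_l2mask => b ib; exact: Sb.
Qed.

Lemma psd_hess i j : psd (hess i j).
Proof. by apply: psd_mask (psd_node i) => x; exact: node_op_block. Qed.

Lemma norm_hess i j x (L : R) : sigma i <= L ->
  (forall b, paired_at i b -> sigma i + 2 * c <= L) -> `|hess i j x| <= L * `|x|.
Proof.
move=> sL scL; apply: le_trans (norm_mask _ _) _.
apply: le_trans (ler_normD _ _) _; rewrite !normrZ.
rewrite (gtr0_norm (sigma_gt0 i)) (gtr0_norm c_gt0).
have le2 b : `|x - swap b x| <= 2 * `|x|.
  by rewrite (le_trans (ler_normB _ _))// /swap norm_permute mulr_natl mulr2n.
have le_paired b : paired_at i b ->
    sigma i * `|x| + c * `|x - swap b x| <= L * `|x|.
  move=> /scL ib; apply: (@le_trans _ _ ((sigma i + 2 * c) * `|x|)).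
    by rewrite mulrDl lerD2l (mulrC 2 c) -mulrA ler_pM2l.
  by rewrite ler_wpM2r.
rewrite /laplacian; case: eqP => [iu|_]; first by apply: le_paired; exact/eqP.
case: eqP => [iv|_]; first by apply: le_paired; exact/eqP.
by rewrite normr0 mulr0 addr0 ler_wpM2r.
Qed.

Lemma sum_block x : \sum_(j < m) l2mask (block m j) x = x.
Proof.
apply: l2P => p; rewrite l2sumE (bigD1 (Ordinal (ltn_pmod p m_gt0)))//=.
rewrite l2maskE /block eqxx big1 ?addr0// => j jp.
rewrite l2maskE /block ifN// eq_sym.
by apply: contraNneq jp => jp; apply/eqP/val_inj.
Qed.

Lemma hard_convex i j : convex (hard i j).
Proof. exact: quad_convex (psd_hess i j). Qed.

Lemma hard_smooth i j L : sigma i <= L ->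
  (forall b, paired_at i b -> sigma i + 2 * c <= L) -> smooth L (hard i j).
Proof.
by move=> sL scL; apply: quad_smooth (psd_hess i j) _ => z; exact: norm_hess.
Qed.

Lemma sum_hardE i : (fun x => \sum_(j < m) hard i j x) =
  quad (node_op i) (\sum_(j < m) lin i j).
Proof.
apply/funext => x; rewrite quad_sum; congr (quad _ _ x).
by apply/funext => y; rewrite sum_block.
Qed.

Lemma hard_strongly_convex i :
  strongly_convex (sigma i) (fun x => \sum_(j < m) hard i j x).
Proof.
rewrite sum_hardE; apply: quad_strongly_convex.
exact: (psd_scale (ltW c_gt0) (psd_laplacian_node i)).
Qed.

Lemma sum_lin : \sum_i \sum_(j < m) lin i j = source.
Proof.
rewrite (bigD1 u)//= [X in _ + X]big1 ?addr0 => [|i iu].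
  by under eq_bigr do rewrite /lin eqxx; exact: sum_block.
by rewrite big1// => j _; rewrite /lin (negbTE iu).
Qed.

Lemma sum_node_op x : \sum_i node_op i x =
  mu *: x + c *: (x - swap false x) + c *: (x - swap true x).
Proof.
rewrite big_split/= -scaler_suml -addrA; congr (_ + _).
rewrite (bigD1 u)//= (bigD1 v) 1?eq_sym//= big1 ?addr0 => [|i /andP[iu iv]].
  by rewrite /laplacian !eqxx eq_sym (negbTE u_neq_v).
by rewrite /laplacian (negbTE iu) (negbTE iv) scaler0.
Qed.

Lemma sum_node_op_thetas : \sum_i node_op i thetas = source.
Proof.
rewrite sum_node_op /swap; apply: l2P => p.
rewrite /source !(l2BE, l2DE, l2ZE, l2maskE, permuteE) !thetasE.
rewrite !coord_swap_div// /level_swap addbT addbF.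
have -> : (p < m)%N = (p %/ m == 0)%N.
  case: ltnP => [pm|mp]; first by rewrite divn_small.
  by apply/esym/negbTE; rewrite -lt0n divn_gt0.
case: (p %/ m)%N => [|k] /=.
  by rewrite expr0 expr1; ring.
(* The residual at a positive level is a multiple of this null quantity. *)
have eq0 r : r * (mu * q - c * (1 - q) ^+ 2) = 0 by rewrite c_def subrr mulr0.
by case: (odd k) => /=; rewrite mulr0 !exprS -[RHS](eq0 (q ^+ k)); ring.
Qed.

Lemma hard_argmin : is_argmin (fun x => \sum_i \sum_(j < m) hard i j x) thetas.
Proof.
have -> : (fun x => \sum_i \sum_(j < m) hard i j x) =
    quad (fun x => \sum_i node_op i x) (\sum_i \sum_(j < m) lin i j).
  apply/funext => x; rewrite -quad_sum; apply: eq_bigr => i _.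
  by have := congr1 (@^~ x) (sum_hardE i).
apply: quad_argmin; first exact: psd_sum psd_node.
by rewrite sum_node_op_thetas sum_lin.
Qed.

(** The tail must split no pair coupled by the function. Only functions of block [j] itself at [u]
    or [v] constrain the parity of [k]. *)
Lemma hard_reflection i (j' j : 'I_m) k x :
  (forall b, paired_at i b -> j' = j -> odd k (+) b) ->
  hard i j' (reflection (tail m j k) x) = hard i j' x.
Proof.
move=> ok; apply: quad_reflection; first exact: psd_hess.
  move=> y; apply: hess_l2mask => b p ib; rewrite /block /tail => /eqP jp.
  rewrite coord_swap_mod coord_swap_div// jp.
  case: eqP => //= jj; rewrite leq_level_swap//.
  by apply: (ok b ib); exact/val_inj.
rewrite /lin; case: eqP => [iu|_]; last by rewrite l2mask0.
apply/eqP/l2mask_eq0P => p /andP[/eqP pj kp].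
rewrite l2maskE /block pj; case: eqP => // /val_inj jj.
(* An odd [k] is positive, so the tail avoids level 0, where the source lives. *)
have k_odd : odd k by have := ok false; rewrite addbF /paired_at iu eqxx; apply.
rewrite /source l2ZE l2maskE ltnNge.
have -> /= : (m <= p)%N by rewrite -divn_gt0// (leq_trans _ kp)// odd_gt0.
by rewrite mulr0.
Qed.

Lemma first_order_hard i (j' j : 'I_m) k x y :
  (forall b, paired_at i b -> j' = j -> odd k (+) b) ->
  l2mask (tail m j k) x = 0 -> first_order (hard i j') x y ->
  l2mask (tail m j k) y = 0.
Proof.
move=> ok; apply: first_order_reflection; first exact: hard_convex.
by move=> z; exact: hard_reflection.
Qed.

End HardInstance.

(** * Distance to the minimizer at bounded depth *)

Lemma geometric_tail_ge (R : realType) (r : R) D K : 0 <= r -> r <= 1 ->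
  r ^+ D - r ^+ K <= (1 - r) * \sum_(0 <= k < K) (if (D <= k)%N then r ^+ k else 0).
Proof.
move=> r0 r1; elim: K => [|K IH].
  by rewrite big_geq// mulr0 expr0 subr_le0 exprn_ile1.
rewrite big_nat_recr//= mulrDr; case: ifP => [_|DK].
  rewrite (le_trans _ (lerD IH (lexx _)))// le_eqVlt exprS.
  by apply/orP; left; apply/eqP; ring.
(* Here [K.+1 <= D], so the left-hand side is nonpositive. *)
rewrite mulr0 addr0 (@le_trans _ _ 0)//.
  by rewrite subr_le0 ler_wiXn2l// ltnNge DK.
rewrite mulr_ge0 ?subr_ge0// sumr_ge0// => k _.
by case: ifP => // _; rewrite exprn_ge0.
Qed.

(** In block [j] the error contains the whole geometric tail of the minimizer from level [D j] on.
    The sums are cut at [K] levels, then [K] tends to infinity. *)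
Lemma error_ge (R : realType) (m : nat) (m_gt0 : (0 < m)%N) (q : R)
    (q_gt0 : 0 < q) (q_lt1 : q < 1) (D : 'I_m -> nat) (y : l2 R) :
  (forall j : 'I_m, l2mask (tail m j (D j)) y = 0) ->
  \sum_j (q ^+ 2) ^+ D j <=
  (1 - q ^+ 2) * `|y - thetas m_gt0 q_gt0 q_lt1| ^+ 2.
Proof.
move=> yD; set z := y - _; set r := q ^+ 2.
have r0 : 0 <= r by exact: sqr_ge0.
have r1 : r < 1 by rewrite expr_lt1// ltW.
have le_K K : \sum_j r ^+ D j - m%:R * r ^+ K <= (1 - r) * `|z| ^+ 2.
  apply: (@le_trans _ _ ((1 - r) *
      \sum_(0 <= k < K) \sum_(j < m) (if (D j <= k)%N then r ^+ k else 0))).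
    rewrite exchange_big/= mulr_sumr.
    have -> : m%:R * r ^+ K = \sum_(j < m) r ^+ K.
      by rewrite sumr_const card_ord mulr_natl.
    rewrite -sumrB; apply: ler_sum => j _.
    by apply: geometric_tail_ge => //; exact: ltW.
  apply: ler_wpM2l; first by rewrite subr_ge0 ltW.
  apply: le_trans (partial_sum_le z (K * m)); rewrite big_nat_block.
  apply: ler_sum => k _; apply: ler_sum => j _.
  case: ifP => [Dk|_]; last exact: sqr_ge0.
  have div_kj : ((k * m + j) %/ m = k)%N by rewrite divnMDl// divn_small// addn0.
  have y0 : y (k * m + j)%N = 0.
    have /eqP/l2mask_eq0P := yD j; apply.
    by rewrite /tail modnMDl modn_small// eqxx div_kj.
  by rewrite /z l2BE y0 thetasE div_kj sub0r sqrrN exprAC.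
have cv : (fun K => \sum_j r ^+ D j - m%:R * r ^+ K) @ \oo --> \sum_j r ^+ D j.
  rewrite -[X in _ --> X]subr0; apply: cvgB; first exact: cvg_cst.
  rewrite -[X in _ --> X](mulr0 m%:R); apply: cvgMr.
  by apply: cvg_expr; rewrite ger0_norm.
rewrite -(cvg_lim _ cv)//; apply: limr_le; first by apply/cvg_ex; eexists; exact: cv.
by near=> K; exact: le_K.
Unshelve. all: by end_near. Qed.

(** * Progress of a black-box procedure *)

Lemma tail_mask_le (R : realType) m j k l (x : l2 R) : (k <= l)%N ->
  l2mask (tail m j k) x = 0 -> l2mask (tail m j l) x = 0.
Proof.
move=> kl /eqP/l2mask_eq0P x0; apply/eqP/l2mask_eq0P => p /andP[pj lp].
by apply: x0; rewrite /tail pj (leq_trans kl lp).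
Qed.

Section MemoryInduction.
Context {R : realType} {n m : nat}.
Variables (e : rel 'I_n) (tau : R) (f : 'I_n -> 'I_m -> l2 R -> R).
Variables (A : trace R n m) (Q : 'I_n -> R -> set (l2 R)).
Hypotheses (tau_gt0 : 0 < tau) (A_bb : black_box e tau f A).
Hypothesis Q_span : forall i t (B : set (l2 R)) x,
  B `<=` Q i t -> lin_span B x -> Q i t x.
Hypothesis Q_le : forall i s t, 0 <= s -> s <= t -> Q i s `<=` Q i t.
Hypothesis Q_comm : forall i j s, e i j -> 0 <= s -> Q j s `<=` Q i (s + tau).
Hypothesis Q_comp : forall i k x y, 0 <= start A i k -> Q i (start A i k) x ->
  first_order (f i (zeta A i k)) x y -> Q i (start A i k + 1) y.

(** Computations and communications both take at least [min 1 tau], so a memory depends only on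
    memories older by that much, and nothing is stored at negative times: induction on the number of
    such steps. *)
Lemma memory_ind i t x : 0 <= t -> memory A i t x -> Q i t x.
Proof.
have [_ memA _] := A_bb; set dt := Num.min 1 tau.
have dt_gt0 : 0 < dt by rewrite lt_min ltr01.
have [dt1 dtt] : dt <= 1 /\ dt <= tau by rewrite !ge_min !lexx orbT.
suff ind N : forall i t x, 0 <= t -> t < N%:R * dt -> memory A i t x -> Q i t x.
  move=> t0; apply: (ind (Num.truncn (t / dt)).+1) => //.
  by rewrite -ltr_pdivrMr// truncnS_gt.
elim: N => [|N IH] {}i {}t {}x t0 tN.
  by move: tN; rewrite mul0r ltNge t0.
have stored_Q l s y : s < N%:R * dt -> stored A l s y -> 0 <= s /\ Q l s y.
  move=> sN [r /andP[r0 rs] ry]; split; first exact: le_trans rs.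
  by apply: (Q_le r0 rs); apply: IH ry => //; exact: le_lt_trans sN.
have {}tN : t - dt < N%:R * dt by rewrite ltrBlDr -[X in _ + X]mul1r -mulrDl -natr1 in tN *.
move=> /(memA _ _ t0)[]; apply: Q_span => y.
  move=> [j ij /stored_Q[|t1 Qy]]; first by rewrite (le_lt_trans _ tN)// lerB.
  by rewrite -(subrK tau t); exact: Q_comm Qy.
move=> [/stored_Q[|t1 Qy]|[k [z [kt /stored_Q + zy]]]].
- by rewrite (le_lt_trans _ tN)// lerB.
- by apply: Q_le Qy => //; rewrite gerBl.
- case=> [|k0 Qz].
    by rewrite (le_lt_trans _ tN)// lerBrDr (le_trans _ kt)// lerD2l.
  by apply: (Q_le _ kt); [rewrite addr_ge0|exact: Q_comp Qz zy].
Qed.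

End MemoryInduction.

(** The counted calls occupy disjoint unit slots inside [0, t]. *)
Lemma count_calls_le (R : realType) (s : nat -> R) (t : R) B : 0 <= t ->
  (forall k, s k + 1 <= s k.+1) ->
  (\sum_(k < B) ((0 <= s k)%R && (s k + 1 <= t)%R))%N%:R <= t.
Proof.
move=> t0 sS; set N := fun B => (\sum_(k < B) ((0 <= s k)%R && (s k + 1 <= t)%R))%N.
(* The second bound carries the induction: the slots already counted end before call [B] starts. *)
suff: (N B)%:R <= t /\ (N B)%:R <= Num.max 0 (s B) by case.
elim: B => [|B [IHt IHs]]; first by rewrite /N big_ord0 t0 le_max lexx.
have -> : N B.+1 = (N B + ((0 <= s B)%R && (s B + 1 <= t)%R))%N.
  by rewrite /N big_ord_recr.
have sB := sS B; case: andP => [[s0 st]|_] /=.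
  rewrite max_r// in IHs; rewrite natrD; split.
    by rewrite (le_trans _ st)// lerD2r.
  by rewrite le_max (le_trans _ sB) ?orbT// lerD2r.
rewrite addn0; split => //; rewrite (le_trans IHs)// ge_max !le_max lexx/=.
by rewrite (le_trans _ sB) ?orbT// lerDl.
Qed.

(** Start times grow at least linearly, so the calls completed by [t] can be counted by a finite
    sum. *)
Lemma calls_bounded (R : realType) (s : nat -> R) (t : R) :
  (forall k, s k + 1 <= s k.+1) -> exists B, forall k, s k + 1 <= t -> (k < B)%N.
Proof.
move=> sS; have s_ge k : s 0%N + k%:R <= s k.
  elim: k => [|k IH]; first by rewrite addr0.
  by rewrite -natr1 addrA (le_trans _ (sS k))// lerD2r.
exists (Num.truncn `|t - s 0%N|).+1 => k kt.
rewrite -(ltr_nat R) (le_lt_trans _ (truncnS_gt _))// (le_trans _ (ler_norm _))//.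
by rewrite lerBrDl (le_trans (s_ge k))// (le_trans _ kt)// lerDl.
Qed.

Section Progress.
Context {R : realType}.
Variables (m n : nat) (m_gt0 : (0 < m)%N) (u v : 'I_n) (u_neq_v : u != v).
Variables (sigma : 'I_n -> R) (sigma_gt0 : forall i, 0 < sigma i).
Variables (q c : R) (q_gt0 : 0 < q) (q_lt1 : q < 1).
Hypothesis c_def : (\sum_i sigma i) * q = c * (1 - q) ^+ 2.
Variables (e : rel 'I_n) (tau : R) (tau_gt0 : 0 < tau).

Let f := hard m_gt0 u v sigma c q_gt0 q_lt1.

Variables (A : trace R n m) (A_bb : black_box e tau f A).

Let depth_le (j : 'I_m) k (x : l2 R) := l2mask (tail m j k) x = 0.

Let depth_span j k (B : set (l2 R)) x :
  B `<=` depth_le j k -> lin_span B x -> depth_le j k x.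
Proof. by move=> Bk; apply: lin_span_mask => y /Bk. Qed.

Let depth_step i (j' j : 'I_m) k x y :
  (forall b, paired_at u v i b -> j' = j -> odd k (+) b) ->
  depth_le j k x -> first_order (f i j') x y -> depth_le j k y.
Proof. by move=> ok; apply: first_order_hard ok. Qed.

Section Communication.
Variables (h : 'I_n -> nat) (d : nat) (hu : h u = 0%N) (hv : h v = d).
Hypothesis h_le : forall i, (h i <= d)%N.
Hypothesis h_lip : forall i j, e i j -> (h i <= (h j).+1)%N /\ (h j <= (h i).+1)%N.

(* The earliest time at which node [i] can know a vector of depth [k.+1]. *)
Let reach i k : R :=
  (k * d)%:R * tau + (if odd k then d%:R - (h i)%:R else (h i)%:R) * tau.

(** Along an edge [reach] varies by at most [tau], since [h] is 1-Lipschitz. A call at [u] can break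
    depth [k] only for even [k]; if [k] is positive, [reach u k.-1 = reach u k], so the smaller
    depth [k.-1] already holds and is preserved. At [v] the parities are exchanged. *)
Lemma communication_depth i j k (t : R) x : 0 <= t -> t < (k * d)%:R * tau ->
  memory A i t x -> depth_le j k x.
Proof.
pose Q i t : set (l2 R) := [set x | forall k, t < reach i k -> depth_le j k x].
move=> t0 tk Ax; suff : Q i t x.
  apply; apply: lt_le_trans tk _; rewrite lerDl mulr_ge0 ?(ltW tau_gt0)//.
  by case: ifP => // _; rewrite subr_ge0 ler_nat h_le.
apply: (memory_ind tau_gt0 A_bb _ _ _ _ t0 Ax) => {i t k x t0 tk Ax}.
- by move=> i t B x BQ Bx k tk; apply: depth_span Bx => y /BQ; exact.
- by move=> i s t _ st x Qx k tk; apply: Qx; exact: le_lt_trans tk.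
- move=> i l s il _ x Qx k; rewrite -ltrBrDr => sk; apply: Qx.
  apply: lt_le_trans sk _; rewrite /reach -addrA lerD2l lerBlDr.
  have -> (a : R) : a * tau + tau = (a + 1) * tau by rewrite mulrDl mul1r.
  rewrite ler_pM2r//; have [il1 li1] := h_lip il.
  move: il1 li1; rewrite -!(ler_nat R) -!natr1.
  by case: ifP => _ ? ?; lra.
- move=> i a x y s0 Qx xy k sk.
  have {}sk : start A i a < reach i k by apply: le_lt_trans sk; rewrite lerDl.
  have [iu|iu] := eqVneq i u; last have [iv|iv] := eqVneq i v.
  + have [k_odd|] := boolP (odd k).
      apply: depth_step (Qx _ sk) xy => -[]; rewrite ?addbF//.
      by rewrite /paired_at iu (negbTE u_neq_v).
    case: k sk => [|k] /= sk k_odd.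
      (* A call at [u] may break depth 0, but no counted call starts before [reach u 0 = 0]. *)
      by move: sk; rewrite /reach iu hu mul0n !mul0r addr0 ltNge -iu s0.
    apply: (tail_mask_le (leqnSn k)); apply: (depth_step _ (Qx _ _) xy).
      move=> -[]; rewrite ?addbF; first by rewrite /paired_at iu (negbTE u_neq_v).
      by rewrite -(negbK (odd k)).
    move: sk k_odd; rewrite negbK /reach /= iu hu => + k_odd; rewrite k_odd /=.
    by rewrite subr0 mul0r addr0 -mulrDl -natrD mulSn addnC.
  + have [k_odd|k_even] := boolP (odd k); last first.
      apply: depth_step (Qx _ sk) xy => -[]; rewrite ?addbT//.
      by rewrite /paired_at iv eq_sym (negbTE u_neq_v).
    case: k sk k_odd => [//|k] /= sk k_odd.
    apply: (tail_mask_le (leqnSn k)); apply: (depth_step _ (Qx _ _) xy).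
      move=> -[]; rewrite ?addbT// /paired_at iv eq_sym (negbTE u_neq_v)//.
    move: sk; rewrite /reach /= iv hv k_odd (negbTE k_odd).
    by rewrite subrr mul0r addr0 -mulrDl -natrD mulSn addnC.
  + apply: depth_step (Qx _ sk) xy => -[].
      by rewrite /paired_at (negbTE iv).
    by rewrite /paired_at (negbTE iu).
Qed.

End Communication.

Section Computation.

(** Calls starting before time 0 are left out: they have no stored vector to work on. *)
Let calls i B (j : 'I_m) (t : R) : nat :=
  \sum_(k < B) [&& (0 <= start A i k)%R, (start A i k + 1 <= t)%R & zeta A i k == j].

Let calls_le i B j s t : s <= t -> (calls i B j s <= calls i B j t)%N.
Proof.
move=> st; apply: leq_sum => k _; case: (0 <= start A i k) => //=.
by case: (lerP (start A i k + 1) s) => //= ks; rewrite (le_trans ks st).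
Qed.

Let calls_lt i B k t : (k < B)%N -> 0 <= start A i k -> start A i k + 1 <= t ->
  (calls i B (zeta A i k) (start A i k) < calls i B (zeta A i k) t)%N.
Proof.
move=> kB k0 kt.
rewrite /calls (bigD1 (Ordinal kB))//= [ltnRHS](bigD1 (Ordinal kB))//=.
rewrite k0 kt eqxx gerDl ler10 /= add0n add1n ltnS.
apply: leq_sum => l _; case: (0 <= start A i l) => //=.
case: (lerP (start A i l + 1) (start A i k)) => //= ks.
by rewrite (le_trans ks)// (le_trans _ kt)// lerDl.
Qed.

(** [D j] counts the calls on block [j] completed by [u] and [v] together. All nodes share this
    counter, so exchanging vectors never breaks the bound. *)
Lemma computation_depth (t : R) : 0 <= t -> exists D : 'I_m -> nat,
  (\sum_j D j)%:R <= 2 * t /\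
  forall i j x, memory A i t x -> depth_le j (D j) x.
Proof.
move=> t0; have [startS _ _] := A_bb.
have [Bu HBu] := calls_bounded t (startS u).
have [Bv HBv] := calls_bounded t (startS v).
pose N j s := (calls u Bu j s + calls v Bv j s)%N.
exists (fun j => N j t); split.
  rewrite big_split/= natrD mulr_natl mulr2n; apply: lerD.
    apply: le_trans (count_calls_le Bu t0 (startS u)).
    rewrite /calls exchange_big/= ler_nat; apply: leq_sum => k _.
    rewrite (bigD1 (zeta A u k))//= eqxx andbT big1 ?addn0// => j.
    by rewrite eq_sym => /negbTE ->; rewrite !andbF.
  apply: le_trans (count_calls_le Bv t0 (startS v)).
  rewrite /calls exchange_big/= ler_nat; apply: leq_sum => k _.
  rewrite (bigD1 (zeta A v k))//= eqxx andbT big1 ?addn0// => j.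
  by rewrite eq_sym => /negbTE ->; rewrite !andbF.
(* [Bu] and [Bv] bound only the calls completed by [t], hence the guard [s <= t]. *)
pose Q (i : 'I_n) s : set (l2 R) :=
  [set x | s <= t -> forall j, depth_le j (N j s) x].
move=> i j x Ax; suff : Q i t x by apply.
have N_le l r s : r <= s -> (N l r <= N l s)%N.
  by move=> rs; apply: leq_add; exact: calls_le.
apply: (memory_ind tau_gt0 A_bb _ _ _ _ t0 Ax) => {i j x Ax}.
- by move=> i s B x BQ Bx st j; apply: depth_span Bx => y /BQ; exact.
- move=> i r s _ rs x Qx st j; apply: tail_mask_le (Qx (le_trans rs st) j).
  exact: N_le.
- move=> i l s _ s0 x Qx st j.
  have ss : s <= s + tau by rewrite lerDl ltW.
  by apply: tail_mask_le (Qx (le_trans ss st) j); exact: N_le.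
- move=> i a x y a0 Qx xy at_t j; set s := start A i a in a0 Qx at_t *.
  have ss : s <= s + 1 by rewrite lerDl.
  have xj := Qx (le_trans ss at_t) j.
  have [iP|niP] := boolP (((i == u) || (i == v)) && (zeta A i a == j)); last first.
    apply: (tail_mask_le (N_le j _ _ ss)); apply: depth_step xj xy => b ib za.
    by move: niP; rewrite za eqxx andbT; case: b ib => /eqP ->; rewrite eqxx ?orbT.
  have [iuv /eqP za] := andP iP.
  (* The call pays for one more level: it is counted at [s + 1] but not at [s]. *)
  have ltN : (N j s < N j (s + 1)%R)%N.
    rewrite -za; have [iu|iu] := eqVneq i u.
      rewrite /N -addSn leq_add// ?calls_le//.
      by rewrite /s iu; apply: calls_lt; rewrite -?iu// HBu// -iu.
    have /eqP iv : i == v by move: iuv; rewrite (negbTE iu).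
    rewrite /N -addnS leq_add// ?calls_le//.
    by rewrite /s iv; apply: calls_lt; rewrite -?iv// HBv// -iv.
  have uniq_b b : paired_at u v i b -> b = (i == v).
    by case: b => /eqP ->; rewrite ?eqxx// (negbTE u_neq_v).
  (* Of the two consecutive thresholds [N j s] and [(N j s).+1], one has the parity preserved at
     this node. *)
  have [ok|nok] := boolP (odd (N j s) (+) (i == v)).
    apply: (tail_mask_le (N_le j _ _ ss)); apply: depth_step xj xy.
    by move=> b /uniq_b ->.
  apply: (tail_mask_le ltN); apply: (depth_step _ (tail_mask_le (leqnSn _) xj) xy).
  by move=> b /uniq_b -> _ /=; rewrite addNb.
Qed.

End Computation.

End Progress.

(* Jensen's inequality, from the tangent to the exponential at the mean. *)
Lemma mean_expr_ge (R : realType) (m : nat) (D : 'I_m -> nat) (r : R) :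
  0 < r -> (0 < m)%N ->
  expR (ln r * ((\sum_j D j)%:R / m%:R)) <= (\sum_j r ^+ D j) / m%:R.
Proof.
move=> r0 m0; have mR : 0 < m%:R :> R by rewrite ltr0n.
set a := (\sum_j D j)%:R / m%:R.
have tangent j : expR (ln r * a) * (1 + ln r * ((D j)%:R - a)) <= r ^+ D j.
  have -> : r ^+ D j = expR (ln r * a) * expR (ln r * ((D j)%:R - a)).
    by rewrite -expRD -mulrDr addrC subrK mulrC expRM_natl lnK.
  by rewrite ler_pM2l ?expR_gt0// expR_ge1Dx.
rewrite ler_pdivlMr//; apply: le_trans (ler_sum _ (fun j _ => tangent j)).
rewrite -mulr_sumr big_split/= sumr_const card_ord -mulr_sumr sumrB.
have aE : m%:R * a = (\sum_j D j)%:R by rewrite /a mulrC divfK// gt_eqF.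
rewrite sumr_const card_ord -natr_sum -(mulr_natl a) aE.
by rewrite subrr mulr0 addr0.
Qed.

Lemma precision_ge (R : realType) n m (e : rel 'I_n) (tau : R) f (x : l2 R)
    d (T : measurableType d) (P : probability T R) (A : T -> trace R n m)
    (eps t lb : R) : 0 <= t -> 0 <= lb ->
  black_box_procedure e tau f x A ->
  (forall w, black_box e tau f (A w) -> lb <= relative_error x t (A w)) ->
  reaches_precision x P A eps t -> lb <= eps.
Proof.
move=> t0 lb0 [A_bb /(_ t t0) mA] lbA; rewrite /reaches_precision unlock => E.
rewrite -lee_fin (le_trans _ E)// -[leLHS]mule1 -(@probability_setT _ _ _ P).
rewrite -integral_cst//; apply: ge0_le_integral => //.
- exact/measurable_realfun.measurable_EFinP.
- by move=> w _; rewrite lee_fin lbA.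
Qed.

(** * From depth to relative error *)

Section RelativeError.
Context {R : realType}.
Variables (m n : nat) (m_gt0 : (0 < m)%N) (u v : 'I_n) (u_neq_v : u != v).
Variables (sigma : 'I_n -> R) (sigma_gt0 : forall i, 0 < sigma i).
Variables (q c : R) (q_gt0 : 0 < q) (q_lt1 : q < 1).
Hypothesis c_def : (\sum_i sigma i) * q = c * (1 - q) ^+ 2.
Variables (e : rel 'I_n) (tau : R) (tau_gt0 : 0 < tau).

Let f := hard m_gt0 u v sigma c q_gt0 q_lt1.
Let xs := thetas m_gt0 q_gt0 q_lt1.

Variables (A : trace R n m) (A_bb : black_box e tau f A).

(** No call is completed by time 0, so every depth is 0. This fixes the denominator of the relative
    error. *)
Lemma output0 i : output A i 0 = 0.
Proof.
have [D [D0 depth]] := computation_depth u_neq_v sigma_gt0 c_def tau_gt0 A_bb (lexx 0).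
have [_ _ /(_ i 0 (lexx 0))] := A_bb; set x := output A i 0 => Ax.
rewrite -(sum_block m_gt0 x) big1// => j _; have := depth i j x Ax.
suff -> : D j = 0%N.
  move=> /eqP/l2mask_eq0P x0; apply/eqP/l2mask_eq0P => p pj.
  by apply: x0; rewrite /tail leq0n andbT.
move: D0; rewrite mulr0 lern0 sum_nat_eq0 => /forallP /(_ j).
by move=> /implyP /(_ isT)/eqP.
Qed.

(** With [S] the sum over the blocks, each node has squared error at least [S / (1 - q ^+ 2)], while
    the squared norm of the minimizer is at most [m / (1 - q ^+ 2)]. *)
Lemma relative_error_ge (D : 'I_m -> nat) t : 0 <= t ->
  (forall i (j : 'I_m) x, memory A i t x -> l2mask (tail m j (D j)) x = 0) ->
  (\sum_j (q ^+ 2) ^+ D j) / m%:R <= relative_error xs t A.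
Proof.
move=> t0 depth; have n_gt0 : (0 < n)%N by apply: leq_ltn_trans (ltn_ord u).
have m0 : 0 < m%:R :> R by rewrite ltr0n.
have n0 : 0 < n%:R :> R by rewrite ltr0n.
have r1 : 0 < 1 - q ^+ 2 by rewrite subr_gt0 expr_lt1// ltW.
rewrite /relative_error.
rewrite [X in _ <= _ / X](eq_bigr (fun=> `|xs| ^+ 2)) => [|i _]; last first.
  by rewrite output0 sub0r normrN.
rewrite sumr_const card_ord -(mulr_natl (`|xs| ^+ 2)).
have xs0 : 0 < `|xs| ^+ 2 by exact: thetas_neq0.
rewrite ler_pdivlMr; last exact: mulr_gt0 n0 xs0.
set S := \sum_j _.
have S0 : 0 <= S by apply: sumr_ge0 => j _; rewrite exprn_ge0// sqr_ge0.
apply: (@le_trans _ _ (S / m%:R * (n%:R * (m%:R / (1 - q ^+ 2))))).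
  apply: ler_wpM2l; first by rewrite divr_ge0// ltW.
  apply: ler_wpM2l; [exact: ltW|exact: norm_thetas_le].
have -> : S / m%:R * (n%:R * (m%:R / (1 - q ^+ 2))) = \sum_(i < n) S / (1 - q ^+ 2).
  by rewrite sumr_const card_ord -mulr_natl; field; rewrite !gt_eqF.
apply: ler_sum => i _; rewrite ler_pdivrMr// mulrC.
apply: error_ge => j; have [_ _ /(_ i t t0)] := A_bb; exact: depth.
Qed.

(** By convexity only the mean depth over the blocks matters, and it is at most [2 * t / m]. *)
Lemma relative_error_computation t : 0 <= t ->
  expR (ln (q ^+ 2) * (2 * t / m%:R)) <= relative_error xs t A.
Proof.
move=> t0; have [D [Dt depth]] := computation_depth u_neq_v sigma_gt0 c_def tau_gt0 A_bb t0.
apply: le_trans (relative_error_ge t0 depth).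
apply: le_trans (mean_expr_ge _ (exprn_gt0 2 q_gt0) m_gt0).
rewrite ler_expR ler_wnM2l ?ler_pM2r ?invr_gt0 ?ltr0n//.
by rewrite ln_le0// expr_le1// ltW.
Qed.

Lemma relative_error_communication (h : 'I_n -> nat) d k t :
  h u = 0%N -> h v = d -> (forall i, (h i <= d)%N) ->
  (forall i j, e i j -> (h i <= (h j).+1)%N /\ (h j <= (h i).+1)%N) ->
  0 <= t -> t < (k * d)%:R * tau -> (q ^+ 2) ^+ k <= relative_error xs t A.
Proof.
move=> hu hv h_le h_lip t0 tk.
have -> : (q ^+ 2) ^+ k = (\sum_(j < m) (q ^+ 2) ^+ k) / m%:R.
  by rewrite sumr_const card_ord -[X in X / _]mulr_natr mulfK// pnatr_eq0 -lt0n.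
apply: relative_error_ge => // i j x Ax.
exact: (communication_depth u_neq_v sigma_gt0 c_def tau_gt0 A_bb hu hv h_le h_lip) Ax.
Qed.

End RelativeError.

(** * Networks *)

Section InvolutionLaplacian.
Context {R : realType}.
Variables (V I : finType) (X : I -> V -> V) (XK : forall g, involutive (X g)).
Variables (w : I -> R) (w_gt0 : forall g, 0 < w g).
Implicit Types (x y : V -> R) (s : V).

Definition lap x s : R := \sum_g w g * (x s - x (X g s)).

(** A fixed point of [X g] would give a loop; it is discarded here, and its term in [lap]
    vanishes. *)
Definition lap_net : rel 'I_#|V| :=
  fun k l => (k != l) && [exists g, X g (enum_val k) == enum_val l].

Definition lap_mx : 'M[R]_#|V| := \matrix_(k, l)
  \sum_g w g * ((k == l)%:R - (X g (enum_val k) == enum_val l)%:R).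

Definition col_fun (x : 'cV[R]_#|V|) s : R := x (enum_rank s) 0.

Lemma lap_mx_col (x : 'cV[R]_#|V|) k :
  (lap_mx *m x) k 0 = lap (col_fun x) (enum_val k).
Proof.
have delta s : \sum_l (s == enum_val l)%:R * x l 0 = col_fun x s.
  rewrite (bigD1 (enum_rank s))//= enum_rankK eqxx mul1r big1 ?addr0// => l ls.
  case: eqP => [sl|_]; last by rewrite mul0r.
  by rewrite sl enum_valK eqxx in ls.
rewrite mxE (eq_bigr (fun l => \sum_g w g * (((enum_val k == enum_val l)%:R * x l 0)
    - (X g (enum_val k) == enum_val l)%:R * x l 0))) => [|l _].
  rewrite exchange_big; apply: eq_bigr => g _ /=.
  by rewrite -mulr_sumr sumrB !delta.
rewrite mxE mulr_suml; apply: eq_bigr => g _.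
by rewrite (inj_eq enum_val_inj) -mulrA mulrBl.
Qed.

Lemma lap_net_network : is_network lap_net.
Proof.
split=> [k l|k]; last by rewrite /lap_net eqxx.
rewrite /lap_net eq_sym; congr andb; apply/existsP/existsP => -[g /eqP gkl];
  by exists g; rewrite -gkl XK.
Qed.

Lemma lap_mx_sym : lap_mx^T = lap_mx.
Proof.
apply/matrixP => k l; rewrite !mxE; apply: eq_bigr => g _.
rewrite eq_sym; congr (_ * (_ - (nat_of_bool _)%:R)).
by apply/eqP/eqP => <-; rewrite XK.
Qed.

(** The Dirichlet form: substituting [X g s] for [s] symmetrizes the term of each [g]. *)
Lemma lap_energy x :
  \sum_s x s * lap x s = \sum_g w g / 2 * \sum_s (x s - x (X g s)) ^+ 2.
Proof.
rewrite (eq_bigr (fun s => \sum_g x s * (w g * (x s - x (X g s))))); last first.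
  by move=> s _; rewrite mulr_sumr.
rewrite exchange_big/=; apply: eq_bigr => g _.
have swap : \sum_s x s * (x s - x (X g s)) = \sum_s x (X g s) * (x (X g s) - x s).
  rewrite [LHS](reindex (X g))/=; last by exists (X g) => s _; exact: XK.
  by apply: eq_bigr => s _; rewrite XK.
have -> : \sum_s (x s - x (X g s)) ^+ 2 = 2 * \sum_s x s * (x s - x (X g s)).
  rewrite mulr2n mulrDl !mul1r {2}swap -big_split/=; apply: eq_bigr => s _.
  by ring.
rewrite mulrA divfK ?pnatr_eq0// mulr_sumr; apply: eq_bigr => s _; ring.
Qed.

(** A kernel vector has zero energy, so it is invariant under every [X g]; the hypothesis is
    connectedness, in the form that such functions are constant. *)
Lemma lap_gossip :
  (forall x, (forall g s, x (X g s) = x s) -> forall s t, x s = x t) ->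
  gossip_matrix lap_net lap_mx.
Proof.
move=> connected.
have energy_ge0 x g : 0 <= w g / 2 * \sum_s (x s - x (X g s)) ^+ 2.
  by rewrite mulr_ge0 ?divr_ge0 ?(ltW (w_gt0 g))// sumr_ge0// => s _; exact: sqr_ge0.
split.
- exact: lap_mx_sym.
- move=> x; suff -> : (x^T *m lap_mx *m x) 0 0 =
      \sum_g w g / 2 * \sum_s (col_fun x s - col_fun x (X g s)) ^+ 2.
    by rewrite sumr_ge0.
  rewrite -lap_energy -mulmxA mxE (reindex enum_rank)/=; last first.
    by exists enum_val => k _; rewrite ?enum_rankK ?enum_valK.
  by apply: eq_bigr => s _; rewrite mxE lap_mx_col enum_rankK.
- move=> x; split=> [Wx0|[a ->]].
    have en0 : \sum_g w g / 2 * \sum_s (col_fun x s - col_fun x (X g s)) ^+ 2 = 0.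
      rewrite -lap_energy big1// => s _.
      by rewrite -[s]enum_rankK -lap_mx_col Wx0 mxE mulr0.
    have inv g s : col_fun x (X g s) = col_fun x s.
      have /eqP := psumr_eq0P (fun g _ => energy_ge0 _ g) en0 (i:=g) isT.
      rewrite mulf_eq0 gt_eqF ?divr_gt0//= => /eqP sq0.
      have /eqP := psumr_eq0P (fun s _ => sqr_ge0 _) sq0 (i:=s) isT.
      by rewrite sqrf_eq0 subr_eq0 => /eqP.
    have cst := connected _ inv.
    have [k0 _|none] := pickP (fun k : 'I_#|V| => true).
      exists (x k0 0); apply/colP => k; rewrite mxE.
      by have := cst (enum_val k) (enum_val k0); rewrite /col_fun !enum_valK.
    by exists 0; apply/colP => k; have := none k.
  apply/colP => k; rewrite lap_mx_col mxE /lap big1// => g _.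
  by rewrite /col_fun !mxE subrr mulr0.
- move=> k l lk; rewrite /lap_net eq_sym lk/= => /existsPn none.
  rewrite mxE big1// => g _.
  by rewrite (negbTE (none g)) eq_sym (negbTE lk) subrr mulr0.
Qed.

(** [eigenvalue] is about row vectors; symmetry of the matrix turns them into functions on [V]. *)
Lemma lap_eigenvalueP a : reflect
  (exists2 x, (forall s, lap x s = a * x s) & exists s, x s != 0)
  (eigenvalue lap_mx a).
Proof.
apply: (iffP eigenvalueP) => [[y yW y0]|[x xa [s xs]]].
  exists (col_fun y^T).
    move=> s; rewrite -[s]enum_rankK -lap_mx_col -lap_mx_sym -trmx_mul yW.
    by rewrite /col_fun !mxE enum_rankK.
  have /rV0Pn[k yk] := y0.
  by exists (enum_val k); rewrite /col_fun enum_valK mxE.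
exists (\row_k x (enum_val k)).
  apply: trmx_inj; rewrite trmx_mul lap_mx_sym; apply/colP => k.
  rewrite lap_mx_col !mxE -xa; apply: eq_bigr => g _.
  by rewrite /col_fun !mxE !enum_rankK.
by apply/rV0Pn; exists (enum_rank s); rewrite mxE enum_rankK.
Qed.

End InvolutionLaplacian.

(** * Spectrum of weighted hypercubes *)

Section WeightedCube.
Context {R : realType}.
Variables (d : nat) (w : 'I_d.+1 -> R).
Let V := {ffun 'I_d.+1 -> bool}.
Implicit Types (s : V) (i l : 'I_d.+1) (x y : V -> R).

Definition flip i s : V := [ffun l => s l (+) (l == i)].

Lemma flipK i : involutive (flip i).
Proof. by move=> s; apply/ffunP => l; rewrite !ffunE addbK. Qed.

Lemma flipC i l s : flip i (flip l s) = flip l (flip i s).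
Proof. by apply/ffunP => k; rewrite !ffunE addbAC. Qed.

(** The Hamming weight, that is, the distance to the all-false vertex; it serves as the potential
    [h]. *)
Definition height s : nat := \sum_l s l.

Lemma height_flip i s : height (flip i s) = (\sum_(l | l != i) s l + ~~ s i)%N.
Proof.
rewrite /height (bigD1 i)//= ffunE eqxx addbT addnC; congr addn.
by apply: eq_bigr => l li; rewrite ffunE (negbTE li) addbF.
Qed.

Lemma heightE i s : height s = (\sum_(l | l != i) s l + s i)%N.
Proof. by rewrite /height (bigD1 i)//= addnC. Qed.

Lemma height_le s : (height s <= d.+1)%N.
Proof.
rewrite -[leqRHS]card_ord -sum1_card; apply: leq_sum => l _.
by case: (s l).
Qed.

Lemma cube_connected x :
  (forall i s, x (flip i s) = x s) -> forall s t, x s = x t.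
Proof.
move=> inv; pose o : V := [ffun=> false].
suff x0 s : x s = x o by move=> s t; rewrite !x0.
have [N] := ubnP (height s); elim: N s => // N IH s sN.
have [l sl|s0] := pickP (fun l => s l).
  rewrite -(inv l); apply: IH; move: sN; rewrite height_flip (heightE l) sl/=.
  by rewrite addn0 addn1 ltnS.
by congr x; apply/ffunP => l; rewrite ffunE s0.
Qed.

(* The flips commute, so an eigenspace contains a common eigenvector. *)
Lemma cube_common_eigenvector a x (r : seq 'I_d.+1) :
  (forall s, lap flip w x s = a * x s) -> (exists s, x s != 0) ->
  exists y, [/\ forall s, lap flip w y s = a * y s, exists s, y s != 0 &
    forall i, i \in r -> exists b : bool, forall s, y (flip i s) = (-1) ^+ b * y s].
Proof.
move=> xa x0; elim: r => [|i r [y [ya [s ys] yr]]]; first by exists x.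
have lap_flip z t : (forall s, lap flip w z s = a * z s) ->
    lap flip w (z \o flip i) t = a * z (flip i t).
  move=> za; rewrite -za; apply: eq_bigr => l _ /=; by rewrite flipC.
(* The two signed symmetrizations add up to [2 * y], so one of them is nonzero at [s]. *)
pose z (b : bool) t := y t + (-1) ^+ b * y (flip i t).
have za b t : lap flip w (z b) t = a * z b t.
  rewrite /z mulrDr mulrCA -lap_flip// -ya /lap mulr_sumr -big_split/=.
  by apply: eq_bigr => l _; ring.
have zr b l : l \in i :: r ->
    exists c : bool, forall t, z b (flip l t) = (-1) ^+ c * z b t.
  rewrite inE => /predU1P[->|/yr[c yc]].
    exists b => t; rewrite /z flipK mulrDr mulrA -signr_addb addbb mul1r.
    by rewrite addrC.
  exists c => t; rewrite /z flipC !yc; ring.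
have [b zb] : exists b, z b s != 0.
  apply/existsP; apply: contraNT ys; rewrite negb_exists => /forallP z0.
  have := z0 true; have := z0 false; rewrite !negbK /z => /eqP e0 /eqP e1.
  by apply/eqP; move: e0 e1; rewrite expr0 expr1; lra.
by exists (z b); split; [exact: za|by exists s|exact: zr].
Qed.

(** On a common eigenvector each flip acts by a sign, and flip [i] contributes [2 * w i] when its
    sign is -1. *)
Lemma cube_eigenvalue a : eigenvalue (lap_mx flip w) a ->
  exists b : 'I_d.+1 -> bool, a = \sum_i (if b i then 2 * w i else 0).
Proof.
case/(lap_eigenvalueP flipK) => x xa x0.
have [y [ya [s ys] yr]] := cube_common_eigenvector (enum 'I_d.+1) xa x0.
exists (fun i => y (flip i s) != y s).
apply: (mulIf ys); rewrite -ya mulr_suml; apply: eq_bigr => i _.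
have [|b yb] := yr i; first by rewrite mem_enum.
have [E|] := eqVneq (y (flip i s)) (y s); first by rewrite E subrr mulr0 mul0r.
by rewrite yb; case: b {yb} => /=; rewrite ?mul1r ?eqxx// expr1 => _; ring.
Qed.

(** The eigenvectors are the Walsh characters. *)
Lemma cube_sgn_eigenvalue (P : pred 'I_d.+1) :
  eigenvalue (lap_mx flip w) (\sum_(i | P i) 2 * w i).
Proof.
apply/(lap_eigenvalueP flipK).
exists (fun s => \prod_(l | P l) (-1) ^+ s l); last first.
  by exists [ffun=> false]; rewrite big1 ?oner_neq0// => l _; rewrite ffunE.
move=> s; rewrite mulr_suml [RHS]big_mkcond; apply: eq_bigr => i _ /=.
have [Pi|nPi] := boolP (P i); last first.
  rewrite [X in _ - X](eq_bigr (fun l => (-1) ^+ s l)) ?subrr ?mulr0// => l Pl.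
  rewrite ffunE; case: eqP => [li|_]; last by rewrite addbF.
  by rewrite -li Pl in nPi.
rewrite [X in _ - X](bigD1 i)//= (bigD1 i)//= ffunE eqxx addbT.
rewrite [X in _ - _ * X](eq_bigr (fun l => (-1) ^+ s l)) => [|l /andP[_ li]].
  by case: (s i); rewrite /= expr0 expr1; ring.
by rewrite ffunE (negbTE li) addbF.
Qed.

End WeightedCube.

(** The 1-Lipschitz potential [h] certifies that [u] and [v] are at distance at least [d]; the last
    condition reads [d >= 1 / (2 sqrt gamma)]. *)
Definition spread_network (R : realType) (gamma : R) : Prop :=
  exists (n : nat) (e : rel 'I_n) (W : 'M[R]_n) (u v : 'I_n) (h : 'I_n -> nat)
    (d : nat),
  [/\ is_network e, gossip_matrix e W & has_spectral_gap W gamma] /\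
  [/\ u != v, h u = 0%N, h v = d, forall i, (h i <= d)%N &
      forall i j, e i j -> (h i <= (h j).+1)%N /\ (h j <= (h i).+1)%N] /\
  1 <= 4 * gamma * d%:R ^+ 2.

(* The hypercube with one heavy direction has eigenvalues between 2 and
   2 / gamma, and antipodal nodes are at distance about 1 / gamma. *)
Lemma cube_spread (R : realType) (gamma : R) : 0 < gamma -> gamma <= 2^-1 ->
  spread_network gamma.
Proof.
move=> g0 g2; have ig0 : 0 < gamma^-1 by rewrite invr_gt0.
have ig2 : 2 <= gamma^-1 by rewrite -[2]invrK lef_pV2 ?posrE ?invr_gt0.
have [d dE] : exists d, Num.truncn gamma^-1 = d.+2.
  have : (2 <= Num.truncn gamma^-1)%N by rewrite truncn_ge_nat// ltW.
  by case: (Num.truncn _) => [|[|d]] // _; exists d.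
have [dle dgt] : d.+2%:R <= gamma^-1 /\ gamma^-1 < d.+3%:R.
  by rewrite -dE; split; [by rewrite truncn_le ltW|exact: truncnS_gt].
(* The weights add up to [1 / gamma], which makes [2 / gamma] the largest eigenvalue; dimension at
   least 2 leaves a direction of weight 1, which gives the eigenvalue 2. *)
pose w (i : 'I_d.+2) : R := if i == ord0 then gamma^-1 - d.+1%:R else 1.
have w_ge1 i : 1 <= w i.
  by rewrite /w; case: ifP => // _; rewrite lerBrDr addrC natr1.
have w_gt0 i : 0 < w i by exact: lt_le_trans (w_ge1 i).
have sum_w : \sum_i 2 * w i = 2 / gamma.
  rewrite -mulr_sumr big_ord_recl /w eqxx/= sumr_const card_ord.
  by rewrite subrK.
have XK := @flipK d.+1.
pose V := {ffun 'I_d.+2 -> bool}.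
pose u : V := [ffun=> false]; pose v : V := [ffun=> true].
exists #|V|, (lap_net (@flip d.+1)), (lap_mx (@flip d.+1) w), (enum_rank u), (enum_rank v),
  (fun k => height (enum_val k)), d.+2.
split; [split|split; [split|]].
- exact: lap_net_network.
- by apply: lap_gossip => // x; exact: cube_connected.
- exists 2, (2 / gamma); split.
  + split; last by rewrite pnatr_eq0.
    have := cube_sgn_eigenvalue w (pred1 ord_max); rewrite big_pred1_eq.
    by rewrite /w -val_eqE/= mulr1.
  + move=> a /cube_eigenvalue[b ->] a0.
    have [i bi|b0] := pickP b; last first.
      by move: a0; rewrite big1 ?eqxx// => i _; rewrite b0.
    rewrite (bigD1 i)//= bi -[leLHS]addr0 lerD//.
      by rewrite ler_peMr.
    by apply: sumr_ge0 => l _; case: (b l) => //; rewrite mulr_ge0 ?ltW.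
  + by rewrite -sum_w; exact: cube_sgn_eigenvalue predT.
  + move=> a /cube_eigenvalue[b ->]; rewrite -sum_w; apply: ler_sum => i _.
    by case: (b i) => //; rewrite mulr_ge0 ?ltW.
  + by rewrite invf_div mulrC divfK ?pnatr_eq0.
- by rewrite (inj_eq enum_rank_inj); apply/eqP => /ffunP/(_ ord0); rewrite !ffunE.
- by rewrite enum_rankK /height big1// => l _; rewrite ffunE.
- rewrite enum_rankK /height (eq_bigr (fun=> 1%N)) => [|l _]; last by rewrite ffunE.
  by rewrite sum1_card card_ord.
- by move=> i; exact: height_le.
- move=> i j /andP[_ /existsP[l /eqP <-]]; rewrite height_flip (heightE l).
  by case: (enum_val i l); rewrite /=; split; lia.
- have : gamma * gamma^-1 = 1 by rewrite divff ?gt_eqF.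
  move: dle dgt; rewrite -!natr1; have : 0 <= d%:R :> R by [].
  move: (d%:R : R) (gamma^-1) ig2 => D y y2 D0 h1 h2 gy.
  (* From [y = 1 / gamma < d.+3] and [d.+3 <= 2 * d.+2]. *)
  have h3 : y <= 2 * (D + 1 + 1) by lra.
  have : gamma * (y * y) <= gamma * (4 * (D + 1 + 1) ^+ 2).
    rewrite ler_pM2l// (_ : 4 * _ = 2 * (D + 1 + 1) * (2 * (D + 1 + 1))); last by ring.
    by apply: ler_pM => //; lra.
  by rewrite (mulrA gamma y y) gy mul1r => ?; lra.
Qed.

(* A weighted triangle. In ['I_3 = Z/3], its three transpositions are the
   reflections [k |-> g - k]. *)
Lemma triangle_spread (R : realType) (gamma : R) : 2^-1 < gamma -> gamma <= 1 ->
  spread_network gamma.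
Proof.
move=> g2 g1; have g0 : 0 < gamma by rewrite (le_lt_trans _ g2).
have ig1 : 1 <= gamma^-1 by rewrite invf_ge1.
pose X (g k : 'I_3) : 'I_3 := g - k.
have XK g : involutive (X g) by move=> k; rewrite /X subKr.
(* The heavy edge joins 1 and 2. Its weight [a] solves [1 + 2 * a = 3 / gamma], an eigenvalue; the
   other nonzero one is 3. *)
pose w (g : 'I_3) : R := if g == 0 then 3 / 2 * gamma^-1 - 2^-1 else 1.
have w_gt0 g : 0 < w g by rewrite /w; case: ifP => // _; lra.
pose i0 : 'I_3 := @Ordinal 3 0 isT; pose i1 : 'I_3 := @Ordinal 3 1 isT.
pose i2 : 'I_3 := @Ordinal 3 2 isT.
have I3 (k : 'I_3) : [\/ k = i0, k = i1 | k = i2].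
  by case: k => [[|[|[|//]]]] p; [apply: Or31|apply: Or32|apply: Or33]; exact: val_inj.
have lapE (x : 'I_3 -> R) : [/\ lap X w x i0 = 2 * x i0 - x i1 - x i2,
    lap X w x i1 = x i1 - x i0 + (3 / 2 * gamma^-1 - 2^-1) * (x i1 - x i2) &
    lap X w x i2 = x i2 - x i0 + (3 / 2 * gamma^-1 - 2^-1) * (x i2 - x i1)].
  have sum3 (F : 'I_3 -> R) : \sum_g F g = F i0 + F i1 + F i2.
    rewrite !big_ord_recl big_ord0 addr0 addrA.
    by congr (F _ + F _ + F _); exact: val_inj.
  have X0 : [/\ X i0 i0 = i0, X i0 i1 = i2 & X i0 i2 = i1] by split; exact: val_inj.
  have X1 : [/\ X i1 i0 = i1, X i1 i1 = i0 & X i1 i2 = i2] by split; exact: val_inj.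
  have X2 : [/\ X i2 i0 = i2, X i2 i1 = i1 & X i2 i2 = i0] by split; exact: val_inj.
  have [w0 w1 w2] : [/\ w i0 = 3 / 2 * gamma^-1 - 2^-1, w i1 = 1 & w i2 = 1] by split.
  case: X0 X1 X2 => X00 X01 X02 [X10 X11 X12] [X20 X21 X22].
  rewrite /lap !sum3 w0 w1 w2 X00 X01 X02 X10 X11 X12 X20 X21 X22.
  by split; ring.
have eig a : eigenvalue (lap_mx X w) a -> a != 0 -> a = 3 \/ a = 3 / gamma.
  case/(lap_eigenvalueP XK) => x xa [s xs] a0; have [E0 E1 E2] := lapE x.
  have := xa i0; have := xa i1; have := xa i2; rewrite E0 E1 E2 => {E0 E1 E2} e2 e1 e0.
  (* The three eigenvalue equations add up to [a] times this sum being 0. *)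
  have sum0 : x i0 + x i1 + x i2 = 0 by apply: (mulfI a0); rewrite mulr0; lra.
  have [x12|x12] := eqVneq (x i1) (x i2); [left|right].
    apply: (mulIf xs); rewrite -xa; have [E0 E1 E2] := lapE x.
    by case: (I3 s) => ->; rewrite ?E0 ?E1 ?E2 x12; rewrite x12 in sum0; lra.
  apply: (@mulIf _ (x i1 - x i2)); first by rewrite subr_eq0.
  by lra.
exists #|'I_3|, (lap_net X), (lap_mx X w), (enum_rank i0), (enum_rank i1),
  (fun k => (enum_val k != i0) : nat), 1%N.
split; [split|split; [split|]].
- exact: lap_net_network.
- apply: lap_gossip => // x inv s t.
  suff x0 k : x k = x i0 by rewrite !x0.
  have -> : i0 = 0 by exact: val_inj.
  by rewrite -(inv k 0) /X subr0.
- exists 3, (3 / gamma); split.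
  + split; last by rewrite pnatr_eq0.
    apply/(lap_eigenvalueP XK).
    exists (fun k => if k == i0 then - 2 else 1); last first.
      by exists i1; rewrite oner_neq0.
    have [E0 E1 E2] := lapE (fun k => if k == i0 then - 2 else 1 : R).
    by move=> s; case: (I3 s) => ->; rewrite ?E0 ?E1 ?E2 /=; ring.
  + by move=> a /eig + a0 => /(_ a0) [] -> //; rewrite ler_peMr.
  + apply/(lap_eigenvalueP XK).
    exists (fun k => if k == i0 then 0 else if k == i1 then 1 else - 1); last first.
      by exists i1; rewrite oner_neq0.
    have [E0 E1 E2] := lapE (fun k => if k == i0 then 0 else if k == i1 then 1 else - 1 : R).
    by move=> s; case: (I3 s) => ->; rewrite ?E0 ?E1 ?E2 /=; field; rewrite gt_eqF.
  + move=> a aW; have [->|/(eig _ aW)[] ->//] := eqVneq a 0.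
      by rewrite divr_ge0 ?ltW.
    by rewrite ler_peMr.
  + by rewrite invf_div mulrC divfK ?pnatr_eq0.
- by rewrite (inj_eq enum_rank_inj).
- by rewrite enum_rankK eqxx.
- by rewrite enum_rankK.
- by move=> i; case: (_ != _).
- by move=> i j _; case: (_ != _); case: (_ != _).
- by rewrite expr1n mulr1; lra.
Qed.

Lemma spread_network_exists (R : realType) (gamma : R) :
  0 < gamma -> gamma <= 1 -> spread_network gamma.
Proof.
move=> g0 g1; case: (lerP gamma 2^-1) => g2; first exact: cube_spread.
exact: triangle_spread.
Qed.

(** * The lower bound *)

Section Rates.
Context {R : realType}.
Variables (s : R) (s_ge8 : 8 <= s).
Let q : R := 1 - 4 / s.

Let s_gt0 : 0 < s. Proof. exact: lt_le_trans s_ge8. Qed.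

Lemma rate_ge : 2^-1 <= q.
Proof. rewrite /q lerBrDr -lerBrDl ler_pdivrMr//. move: (s : R) s_ge8 => x; lra. Qed.

Lemma rate_lt1 : q < 1.
Proof. by rewrite /q gtrBl divr_gt0. Qed.

(** [1 / q <= 1 + 8 / s <= exp (8 / s)], where the first inequality amounts to [s >= 8]. *)
Lemma ln_rate_ge : - (8 / s) <= ln q.
Proof.
have q0 : 0 < q by exact: lt_le_trans rate_ge.
rewrite -ler_expR lnK// expRN -[leRHS]invrK lef_pV2 ?posrE ?expR_gt0 ?invr_gt0//.
apply: le_trans (expR_ge1Dx _); rewrite -(ler_pM2r q0) mulVf ?gt_eqF// /q.
have -> : (1 + 8 / s) * (1 - 4 / s) = 1 + 4 / s * (1 - 8 / s) by field; rewrite gt_eqF.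
by rewrite lerDl mulr_ge0 ?divr_ge0 ?(ltW s_gt0)// subr_ge0 ler_pdivrMr// mul1r.
Qed.

(* An error decaying as q ^ (2 a) is at most eps only if a is of order
   s * ln (1 / eps). *)
Lemma steps_ge a eps : 0 < eps -> 0 <= a -> expR (ln (q ^+ 2) * a) <= eps ->
  s * ln eps^-1 <= 16 * a.
Proof.
move=> eps0 a0; have q0 : 0 < q by exact: lt_le_trans rate_ge.
rewrite -ler_ln ?posrE ?expR_gt0// expRK lnV ?posrE// lnXn// => h.
have h1 : - (16 / s) * a <= ln q *+ 2 * a.
  rewrite ler_wpM2r// mulr2n; apply: le_trans (lerD ln_rate_ge ln_rate_ge).
  by rewrite le_eqVlt; apply/orP; left; apply/eqP; field; rewrite gt_eqF.
have := le_trans h1 h; rewrite -(ler_pM2l s_gt0).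
have -> : s * (- (16 / s) * a) = - (16 * a) by field; rewrite gt_eqF.
by move: (ln eps) => l ?; rewrite mulrN lerNl.
Qed.

Lemma lower_bound_combine (m d tau gamma kappa kappa_s t l : R) :
  s ^+ 2 = kappa -> 0 < m -> 0 < d -> 0 < tau -> 0 < gamma ->
  1 <= 4 * gamma * d ^+ 2 -> kappa_s <= m * kappa -> 0 <= l ->
  s * l * m <= 32 * t -> s * l * (d * tau) <= 32 * t ->
  100^-1 * (m + Num.sqrt (m * kappa_s) + tau * Num.sqrt (kappa / gamma)) * l <= t.
Proof.
move=> sk m0 d0 tau0 g0 gd ks l0 hm hd.
have sqrt_comp : Num.sqrt (m * kappa_s) <= m * s.
  have h0 : 0 <= m * s by rewrite mulr_ge0// ltW.
  rewrite -[leRHS](ger0_norm h0) -sqrtr_sqr ler_wsqrtr//.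
  by rewrite exprMn sk expr2 -mulrA ler_pM2l.
have sqrt_comm : Num.sqrt (kappa / gamma) <= 2 * d * s.
  have h0 : 0 <= 2 * d * s by rewrite !mulr_ge0// ltW.
  rewrite -[leRHS](ger0_norm h0) -sqrtr_sqr ler_wsqrtr//.
  rewrite ler_pdivrMr// exprMn sk -mulrA (mulrC kappa) mulrA ler_peMl//.
    by rewrite -sk sqr_ge0.
  by apply: le_trans gd _; rewrite le_eqVlt; apply/orP; left; apply/eqP; ring.
rewrite -mulrA ler_pdivrMl//.
(* As [s >= 8], [m] is at most [m * s / 8]; the total is then at most [(9 / 8 + 2) * 32 = 100] times
   [t]. *)
apply: (@le_trans _ _ ((m * (s / 8) + m * s + tau * (2 * d * s)) * l)).
  rewrite ler_wpM2r// !lerD//; last by rewrite ler_pM2l.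
  by apply: ler_peMr; [exact: ltW|rewrite ler_pdivlMr// mul1r].
have -> : (m * (s / 8) + m * s + tau * (2 * d * s)) * l =
  9 / 8 * (s * l * m) + 2 * (s * l * (d * tau)) by field.
lra.
Qed.

End Rates.

Theorem corollary4p3 (R : realType) :
  exists c kappa0 eps0 : R,
  [/\ 0 < c, 0 < kappa0 & 0 < eps0] /\
  forall (gamma kappa_l : R) (m : nat),
  0 < gamma -> gamma <= 1 -> 0 < kappa_l -> kappa0 <= kappa_l -> (0 < m)%N ->
  exists (n : nat) (e : rel 'I_n) (W : 'M[R]_n)
         (f : 'I_n -> 'I_m -> l2 R -> R)
         (L : 'I_n -> 'I_m -> R) (sigma : 'I_n -> R) (thetas : l2 R),
  [/\ is_network e, gossip_matrix e W & has_spectral_gap W gamma] /\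
  [/\ forall i j, convex (f i j),
      forall i j, smooth (L i j) (f i j),
      forall i, 0 < sigma i /\
        strongly_convex (sigma i) (fun theta => \sum_(j < m) f i j theta),
      forall i j, L i j / sigma i <= kappa_l
    & is_argmin (fun theta => \sum_(i < n) \sum_(j < m) f i j theta) thetas] /\
  forall (tau kappa_s : R),
  0 < tau ->
  (forall i, \sum_(j < m) L i j / sigma i <= kappa_s) ->
  kappa_s <= m%:R * kappa_l ->
  forall (d : measure_display) (T : measurableType d) (P : probability T R)
         (A : T -> trace R n m),
  black_box_procedure e tau f thetas A ->
  forall eps t : R,
  0 < eps -> eps <= eps0 -> 0 <= t ->
  reaches_precision thetas P A eps t ->
  c * (m%:R + Num.sqrt (m%:R * kappa_s) + tau * Num.sqrt (kappa_l / gamma))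
    * ln eps^-1 <= t.
Proof.
(* 64 makes [s = sqrt kappa] at least 8, [exp (-4)] makes [s * ln (1 / eps)] at least 32, and 100
   comes from [lower_bound_combine]. *)
exists 100^-1, 64, (expR (- 4)); split.
  by split; rewrite ?invr_gt0 ?expR_gt0.
move=> gamma kappa m gamma0 gamma1 kappa0 kappa64 m0.
have [n [e [W [u [v [h [d [eW [[uv hu hv hle hlip] gd]]]]]]]]] :=
  spread_network_exists gamma0 gamma1.
have n0 : 0 < n%:R :> R by rewrite ltr0n (leq_ltn_trans _ (ltn_ord u)).
have d0 : 0 < d%:R :> R.
  rewrite ltr0n lt0n; apply: contraTneq gd => ->.
  by rewrite expr0n mulr0 -ltNge.
pose s := Num.sqrt kappa.
have sk : s ^+ 2 = kappa by rewrite sqr_sqrtr// ltW.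
have s8 : 8 <= s.
  rewrite -[8]ger0_norm// -sqrtr_sqr ler_wsqrtr//.
  by apply: le_trans kappa64; rewrite expr2 -natrM.
have s0 : 0 < s by exact: lt_le_trans s8.
pose q := 1 - 4 / s; have q1 : q < 1 by exact: rate_lt1.
have q0 : 0 < q by apply: lt_le_trans (rate_ge s8).
(* The value [1 / n] at the other nodes keeps the total [mu] at most 3 for every network size. *)
pose sigma (i : 'I_n) : R := if (i == u) || (i == v) then 1 else n%:R^-1.
have sigma0 i : 0 < sigma i by rewrite /sigma; case: ifP => // _; rewrite invr_gt0.
pose mu := \sum_i sigma i.
have mu0 : 0 <= mu by apply: sumr_ge0 => i _; exact: ltW.
have mu3 : mu <= 3.
  rewrite /mu (bigD1 u)//= (bigD1 v) 1?eq_sym//=.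
  rewrite {1 2}/sigma !eqxx orbT addrA.
  apply: (@le_trans _ _ (1 + 1 + \sum_(i < n) n%:R^-1)).
    rewrite lerD2l [leRHS](bigD1 u)//= [X in _ + X](bigD1 v) 1?eq_sym//=.
    have in0 : 0 <= n%:R^-1 :> R by rewrite invr_ge0 ltW.
    rewrite -[leLHS]add0r lerD// -[leLHS]add0r lerD//.
    by apply: ler_sum => i /andP[iu iv]; rewrite /sigma (negbTE iu) (negbTE iv).
  by rewrite sumr_const card_ord -[X in _ + X <= _]mulr_natl divff ?gt_eqF//; lra.
pose c := mu * q / (1 - q) ^+ 2.
have c_def : mu * q = c * (1 - q) ^+ 2.
  by rewrite /c divfK// expf_eq0/= subr_eq0 gt_eqF.
(* As [1 - q = 4 / s], [c = mu * q * kappa / 16 <= 3 * kappa / 16]. *)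
have cE : 1 + 2 * c <= kappa.
  have -> : c = mu * q * kappa / 16.
    have -> : c = mu * q / (4 / s) ^+ 2 by rewrite /c /q subKr.
    by rewrite -sk; field; rewrite gt_eqF.
  have : mu * q * kappa <= 3 * kappa.
    apply: ler_wpM2r; first exact: ltW.
    by rewrite -[3]mulr1 ler_pM// ltW.
  by move: (mu * q * kappa) => *; lra.
pose f := hard m0 u v sigma c q0 q1.
exists n, e, W, f, (fun i _ => kappa * sigma i), sigma, (thetas m0 q0 q1).
split=> //; split.
  split.
  - by move=> i j; exact: hard_convex.
  - move=> i j; apply: hard_smooth => //.
      by apply: ler_peMl; [exact: ltW|move: kappa64; clear; lra].
    move=> b; rewrite /paired_at => ib.
    have -> : sigma i = 1 by rewrite /sigma; case: b ib => ->; rewrite ?orbT.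
    by rewrite mulr1.
  - by move=> i; split=> //; exact: hard_strongly_convex.
  - by move=> i j; rewrite mulfK// gt_eqF.
  - exact: hard_argmin.
move=> tau kappa_s tau0 _ ks disp T P A bbA eps t eps0 eps4 t0 prec.
have l4 : 4 <= ln eps^-1.
  by rewrite lnV ?posrE// lerNr -[leRHS]expRK ler_ln ?posrE ?expR_gt0.
have mR0 : 0 < m%:R :> R by rewrite ltr0n.
apply: (@lower_bound_combine _ s _ _ d%:R) => //.
- by rewrite (le_trans _ l4).
- have comp : s * ln eps^-1 <= 16 * (2 * t / m%:R).
    apply: (steps_ge s8 eps0); first by rewrite divr_ge0// mulr_ge0.
    apply: (precision_ge t0 (expR_ge0 _) bbA _ prec) => w Aw.
    exact: (relative_error_computation uv sigma0 c_def tau0 Aw t0).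
  move: comp; rewrite mulrA ler_pdivlMr// => comp.
  by rewrite (le_trans comp)// mulrA -natrM.
- pose D := d%:R * tau; have D0 : 0 < D by exact: mulr_gt0.
  pose K := Num.truncn (t / D).
  have tK : t < (K.+1 * d)%:R * tau.
    by rewrite natrM -mulrA -ltr_pdivrMr// truncnS_gt.
  have comm : s * ln eps^-1 <= 16 * K.+1%:R.
    apply: (steps_ge s8 eps0 (ler0n _ _)).
    rewrite expRM_natr lnK ?posrE ?exprn_gt0//.
    apply: (precision_ge t0 (exprn_ge0 _ (sqr_ge0 q)) bbA _ prec) => w Aw.
    exact: (relative_error_communication uv sigma0 c_def tau0 Aw hu hv hle hlip t0 tK).
  have Kt : K%:R * D <= t.
    by rewrite -ler_pdivlMr// truncn_le divr_ge0// ltW.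
  (* With [comm] this forces [K >= 1], so [16 * K.+1 <= 32 * K]: rounding [t / D] down costs only a
     factor 2. *)
  have : 32 <= s * ln eps^-1 by rewrite (_ : 32 = 8 * 4) ?ler_pM// -natrM.
  move: (s * ln eps^-1) comm => S; rewrite -(natr1 K) => comm S32.
  rewrite -/D (@le_trans _ _ (32 * (K%:R * D)))// ?ler_pM2l// mulrA ler_pM2r//.
  by move: comm S32; clear; move: (K%:R) => k; lra.
Qed.
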